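(* Consider an asynchronous restless bandit problem $(\mathbf Q^0,\mathbf Q^1,\mathbf R^0,\mathbf R^1;\alpha)$ such that: (i) the bandit is unichain and strictly indexable; (ii) the unique fixed point $\mathbf m^*$ of the ODE $\dot{\mathbf m}=\tau(\phi(\mathbf m)-\mathbf m)$ is a uniform global attractor of its trajectories, i.e. for every $\epsilon>0$ there is $T(\epsilon)$ such that the solution $\Phi_t\mathbf m$ started at any $\mathbf m\in\Delta^d$ satisfies $\|\Phi_t\mathbf m-\mathbf m^*\|\le\epsilon$ for all $t\ge T(\epsilon)$; (iii) $\mathbf m^*$ is not singular. Then there exist constants $b,c>0$ depending only on $\mathbf Q^0,\mathbf Q^1,\mathbf R^0,\mathbf R^1,\alpha$ such that for every $N$ with $\alpha N\in\mathbb N$, $$0\le V^{(N)}_{\mathrm{rel}}(\alpha)-V^{(N)}_{\mathrm{WIP\text{-}async.}}(\alpha)\le b\,e^{-cN}.$$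
   Context: Asynchronous restless bandit model with parameters $(\mathbf Q^0,\mathbf Q^1,\mathbf R^0,\mathbf R^1;\alpha,N)$: $\mathbf Q^0,\mathbf Q^1$ are $d\times d$ generator matrices ($Q^a_{ij}\ge0$ for $i\ne j$, rows summing to $0$); $N$ bandits with states $S_n(t)\in\{1,\dots,d\}$, $t\in\mathbb R_+$; the action vector $\mathbf a(t)\in\{0,1\}^N$ with $\sum_na_n(t)=\alpha N$ may be changed only at jump times of $\mathbf S(t)$; given actions, bandits evolve independently, bandit $n$ jumping from $i$ to $j\ne i$ at rate $Q^{a_n(t)}_{ij}$; the reward rate is $\sum_nR^{a_n(t)}_{S_n(t)}$. $V^{(N)}_{\mathrm{rel}}(\alpha)$ is the supremum over stationary Markov policies of $\lim_T\frac1T\mathbb E[\int_0^T\sum_nR^{a_n(t)}_{S_n(t)}dt]$ under $\lim_T\frac1T\int_0^T\sum_na_n(t)dt=\alpha N$. Unichain: under every policy a single bandit's state space is one recurrent class. Indexability and Whittle indices: subsidy-$\nu$ problem for one bandit with extra reward $\nu$ per unit time under the passive action, $\omega(\nu)$ the set of states where passivity is optimal, indexable if $\omega$ is nondecreasing in $\nu$, $\nu_i=\inf\{\nu:i\in\omega(\nu)\}$; strictly indexable: all $\nu_i$ distinct, states labeled $\nu_1>\dots>\nu_d$. WIP-async: at every time the $\alpha N$ bandits with highest indices are active; $V^{(N)}_{\mathrm{WIP\text{-}async.}}(\alpha)$ is its long-run average reward per unit time. Let $\tau:=\max_i\max_a|Q^a_{ii}|$, $P^a_{ij}:=Q^a_{ij}/\tau$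 ($i\ne j$), $P^a_{ii}:=1-\sum_{k\neq i}P^a_{ik}$. $\Delta^d=\{\mathbf m\in[0,1]^d:\sum m_i=1\}$; $s(\mathbf m)$ is the unique $s$ with $\sum_{i<s}m_i\le\alpha<\sum_{i\le s}m_i$; $\phi_j(\mathbf m)=\sum_{i=1}^{s(\mathbf m)-1} m_i P^1_{ij} + (\alpha-\sum_{i=1}^{s(\mathbf m)-1}m_i)P^1_{s(\mathbf m)j} + (\sum_{i=1}^{s(\mathbf m)}m_i - \alpha)P^0_{s(\mathbf m)j} + \sum_{i=s(\mathbf m)+1}^{d} m_i P^0_{ij}$. $\mathbf m$ is singular if $\sum_{j\le i}m_j=\alpha$ for some $i$. $\|\cdot\|$ is the sup norm. *)

(* Defs.v *)
From HB Require Import structures.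
From mathcomp Require Import all_boot all_order all_algebra.
From mathcomp Require Import all_classical all_reals all_analysis.
Set Implicit Arguments. Unset Strict Implicit. Unset Printing Implicit Defensive.
Import Order.TTheory GRing.Theory Num.Theory.
Import numFieldNormedType.Exports.
Local Open Scope classical_set_scope.
Local Open Scope ring_scope.

Fixpoint mxpowf (R : realType) (X : finType) (G : X -> X -> R) (k : nat) : X -> X -> R :=
  match k with
  | 0 => fun x y => (x == y)%:R
  | k'.+1 => fun x y => \sum_(z : X) mxpowf G k' x z * G z y
  end.

Definition trans (R : realType) (X : finType) (G : X -> X -> R) (t : R) (x y : X) : R :=
  limn (series (fun k : nat => t ^+ k / (k`!)%:R * mxpowf G k x y)).

(* E[ int_0^T f(X_t) dt ] for the CTMC with generator G and initial law mu0 *)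
Definition exp_cum (R : realType) (X : finType) (G : X -> X -> R) (mu0 : X -> R)
    (f : X -> R) (T : R) : R :=
  \int[lebesgue_measure]_(t in `[0, T]) (\sum_(x : X) \sum_(y : X) mu0 x * trans G t x y * f y).

Definition lr_avg (R : realType) (X : finType) (G : X -> X -> R) (mu0 : X -> R)
    (f : X -> R) : R :=
  lim ((fun T : R => exp_cum G mu0 f T / T) @ +oo).

(* Model data: Q a = Q^a (a = false : passive, a = true : active),     *)
(* Rw a = R^a, states 'I_d.                                            *)

Definition is_generator (R : realType) (d : nat) (Q : 'I_d -> 'I_d -> R) : Prop :=
  (forall i j : 'I_d, i != j -> 0 <= Q i j) /\ (forall i : 'I_d, \sum_(j : 'I_d) Q i j = 0).

(* unichain (as in the context): under every (deterministic stationary)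
   policy the state space of a single bandit is a single recurrent class,
   i.e. every state is reachable from every state. *)
Definition unichain (R : realType) (d : nat) (Q : bool -> 'I_d -> 'I_d -> R) : Prop :=
  forall (pol : 'I_d -> bool) (i j : 'I_d),
    connect [rel k l : 'I_d | 0 < Q (pol k) k l] i j.

Definition sub_gain (R : realType) (d : nat) (Q : bool -> 'I_d -> 'I_d -> R)
    (Rw : bool -> 'I_d -> R) (nu : R) (pol : 'I_d -> bool) (i0 : 'I_d) : R :=
  lr_avg (fun i j : 'I_d => Q (pol i) i j) (fun i => (i == i0)%:R)
    (fun i => Rw (pol i) i + (if pol i then 0 else nu)).

Definition sub_optimal (R : realType) (d : nat) (Q : bool -> 'I_d -> 'I_d -> R)
    (Rw : bool -> 'I_d -> R) (nu : R) (pol : 'I_d -> bool) : Prop :=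
  forall (pol' : 'I_d -> bool) (i0 : 'I_d), sub_gain Q Rw nu pol' i0 <= sub_gain Q Rw nu pol i0.

Definition omega (R : realType) (d : nat) (Q : bool -> 'I_d -> 'I_d -> R)
    (Rw : bool -> 'I_d -> R) (nu : R) : set 'I_d :=
  [set i | exists pol : 'I_d -> bool, sub_optimal Q Rw nu pol /\ pol i = false].

Definition indexable (R : realType) (d : nat) (Q : bool -> 'I_d -> 'I_d -> R)
    (Rw : bool -> 'I_d -> R) : Prop :=
  forall nu nu' : R, nu <= nu' -> omega Q Rw nu `<=` omega Q Rw nu'.

Definition whittle (R : realType) (d : nat) (Q : bool -> 'I_d -> 'I_d -> R)
    (Rw : bool -> 'I_d -> R) (i : 'I_d) : R :=
  inf [set nu : R | omega Q Rw nu i].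

Definition tau (R : realType) (d : nat) (Q : bool -> 'I_d -> 'I_d -> R) : R :=
  \big[Num.max/0]_(i : 'I_d) Num.max `|Q false i i| `|Q true i i|.

Definition Pu (R : realType) (d : nat) (Q : bool -> 'I_d -> 'I_d -> R) (a : bool) (i j : 'I_d) : R :=
  if i == j then 1 - \sum_(k : 'I_d | k != i) Q a i k / tau Q else Q a i j / tau Q.

Definition in_simplex (R : realType) (d : nat) (m : 'I_d -> R) : Prop :=
  (forall i, 0 <= m i) /\ \sum_(i : 'I_d) m i = 1.

Definition sidx (R : realType) (d : nat) (alpha : R) (m : 'I_d -> R) : option 'I_d :=
  [pick s : 'I_d | (\sum_(i : 'I_d | (i < s)%N) m i <= alpha)
                   && (alpha < \sum_(i : 'I_d | (i <= s)%N) m i)].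

(* phi(m); outside the simplex (where s(m) may not exist) an arbitrary value *)
Definition phi (R : realType) (d : nat) (Q : bool -> 'I_d -> 'I_d -> R) (alpha : R)
    (m : 'I_d -> R) : 'I_d -> R := fun j =>
  match sidx alpha m with
  | Some s =>
      \sum_(i : 'I_d | (i < s)%N) m i * Pu Q true i j
      + (alpha - \sum_(i : 'I_d | (i < s)%N) m i) * Pu Q true s j
      + (\sum_(i : 'I_d | (i <= s)%N) m i - alpha) * Pu Q false s j
      + \sum_(i : 'I_d | (s < i)%N) m i * Pu Q false i j
  | None => m j
  end.

Definition singular (R : realType) (d : nat) (alpha : R) (m : 'I_d -> R) : Prop :=
  exists i : 'I_d, \sum_(j : 'I_d | (j <= i)%N) m j = alpha.

Definition uniform_attractor (R : realType) (d : nat) (Q : bool -> 'I_d -> 'I_d -> R)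
    (alpha : R) (mstar : 'I_d -> R) : Prop :=
  forall eps : R, 0 < eps -> exists T : R,
    forall (m : 'I_d -> R), in_simplex m ->
    forall x : R -> 'I_d -> R,
      x 0 = m ->
      (forall t : R, 0 <= t -> in_simplex (x t)) ->
      (forall (t : R) (i : 'I_d), 0 <= t ->
         is_derive t 1 (fun u : R => x u i) (tau Q * (phi Q alpha (x t) i - x t i))) ->
      forall t : R, T <= t -> forall i : 'I_d, `|x t i - mstar i| <= eps.

Definition bstate (N d : nat) := {ffun 'I_N -> 'I_d}.
Definition bact (N : nat) := {ffun 'I_N -> bool}.

Definition is_rpolicy (R : realType) (N d : nat) (pol : bstate N d -> bact N -> R) : Prop :=
  forall s, (forall a, 0 <= pol s a) /\ \sum_(a : bact N) pol s a = 1.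

Definition onlydiff (N d : nat) (s s' : bstate N d) (n : 'I_N) : bool :=
  (s n != s' n) && [forall m : 'I_N, (m != n) ==> (s m == s' m)].

(* generator of the Markov process (S(t), a(t)): bandit n jumps i -> j at
   rate Q^{a_n}_{ij}; at every jump of S a new action vector is drawn
   from the policy in the new state (actions only change at jump times). *)
Definition brate (R : realType) (N d : nat) (Q : bool -> 'I_d -> 'I_d -> R)
    (pol : bstate N d -> bact N -> R) (x y : bstate N d * bact N) : R :=
  (\sum_(n : 'I_N) (onlydiff x.1 y.1 n)%:R * Q (x.2 n) (x.1 n) (y.1 n)) * pol y.1 y.2.

Definition bgen (R : realType) (N d : nat) (Q : bool -> 'I_d -> 'I_d -> R)
    (pol : bstate N d -> bact N -> R) (x y : bstate N d * bact N) : R :=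
  if x == y then - \sum_(z : bstate N d * bact N | z != x) brate Q pol x z
  else brate Q pol x y.

Definition binit (R : realType) (N d : nat) (pol : bstate N d -> bact N -> R)
    (s0 : bstate N d) (x : bstate N d * bact N) : R :=
  (x.1 == s0)%:R * pol s0 x.2.

Definition breward (R : realType) (N d : nat) (Rw : bool -> 'I_d -> R)
    (x : bstate N d * bact N) : R :=
  \sum_(n : 'I_N) Rw (x.2 n) (x.1 n).

Definition bactive (R : realType) (N d : nat) (x : bstate N d * bact N) : R :=
  (\sum_(n : 'I_N) (x.2 n : nat))%:R.

Definition Vrel (R : realType) (N d : nat) (Q : bool -> 'I_d -> 'I_d -> R)
    (Rw : bool -> 'I_d -> R) (alpha : R) (s0 : bstate N d) : R :=
  sup [set v : R | exists pol : bstate N d -> bact N -> R,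
         is_rpolicy pol
         /\ lr_avg (bgen Q pol) (binit pol s0) (@bactive R N d) = alpha * N%:R
         /\ v = lr_avg (bgen Q pol) (binit pol s0) (breward Rw)].

(* WIP-async with K = alpha N active bandits: states are labelled so that
   state 0 has the highest Whittle index; ties between bandits in the same
   state are broken by bandit label. *)
Definition wip_act (N d : nat) (K : nat) (s : bstate N d) : bact N :=
  [ffun n : 'I_N =>
     (#|[set m : 'I_N | ((s m < s n)%N || ((s m == s n) && (m < n)%N))]| < K)%N].

Definition wip_pol (R : realType) (N d : nat) (K : nat) (s : bstate N d) (a : bact N) : R :=
  (a == wip_act K s)%:R.

Definition Vwip (R : realType) (N d : nat) (Q : bool -> 'I_d -> 'I_d -> R)
    (Rw : bool -> 'I_d -> R) (K : nat) (s0 : bstate N d) : R :=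
  lr_avg (bgen Q (@wip_pol R N d K)) (binit (@wip_pol R N d K) s0) (breward Rw).

(* Main.v *)
Require Import Defs.
From HB Require Import structures.
From mathcomp Require Import all_boot all_order all_algebra.
From mathcomp Require Import all_classical all_reals all_analysis.
From mathcomp Require Import ring lra.
Set Implicit Arguments. Unset Strict Implicit. Unset Printing Implicit Defensive.
Import Order.TTheory GRing.Theory Num.Theory.
Import numFieldNormedType.Exports.
Local Open Scope ring_scope.

(** Let [s] be the state in which the water level [alpha] of [mstar] falls and
    let [nu] be its Whittle index.  At subsidy [nu] the single-bandit Bellman
    equation has a solution [(g, h)] for which activity is optimal in the states
    [<= s] and passivity in the states [>= s].  Summing [h] over the bandits,
    the reward of any policy for [N] bandits with activity [alpha N] is
    [N (g - nu) + nu alpha N] minus the long-run average of the nonnegative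
    Bellman gaps; under the Whittle policy these gaps all vanish as long as the
    empirical measure [M] has the same critical state [s] as [mstar].  So
    [Vrel - Vwip] is at most [O(N)] times the long-run probability that [M] is
    far from [mstar].  That probability is exponentially small: along a fluid
    trajectory [x] started at [M 0], with [theta] decreasing fast enough,
    [exp (N theta(t) |M - x(t)|^2)] has drift at most [tau] times itself, which
    bounds the probability that [M T] is far from [x T], uniformly in the initial
    state, and [x T] is close to [mstar] because [mstar] is a uniform
    attractor. *)

(** * Differentiation and matrix exponentials *)

Section Derivatives.
Local Open Scope classical_set_scope.
Variable R : realType.
Implicit Types (f g : R -> R) (x a b c : R).

(** Three obstacles shape the proof. First, the joint chain lives on pairs of a state and an action
    vector and need not be irreducible, so averages are not expressed through a stationary law.
    Every observable is split as [f = u + G w] with [G u = 0]: the average is read off [u], and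
    [G w] contributes nothing. The average is unchanged when [f] is replaced by [exp (T G) f], and
    this turns an estimate at one time [T], uniform over starting states, into an estimate of a
    long-run frequency. Second, the attractor hypothesis speaks of given solutions of the ODE, so
    one has to be constructed from every empirical measure. For this the field is rewritten, without
    the index [s(m)], in a globally Lipschitz form. Third, the constants must not depend on [N].
    Since [alpha N] is an integer, the drift of [M] is exactly the fluid drift at [M]. Jumps have
    size of order [1/N], so each changes [N |M - x|^2] by O(1), and the second-order terms of all
    [N] bandits add up to O(1). The time [T] comes from the attractor alone. Both actions are
    optimal in state [s] at subsidy [nu] because [nu] is approached from below and from above. *)

Lemma der_cst x c : is_derive x 1 (fun=> c) (0 : R).
Proof. exact: is_derive_cst. Qed.

Lemma derD x f g a b : is_derive x 1 f a -> is_derive x 1 g b ->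
  is_derive x 1 (fun t => f t + g t) (a + b).
Proof. by move=> df dg; exact: is_deriveD. Qed.

Lemma derN x f a : is_derive x 1 f a -> is_derive x 1 (fun t => - f t) (- a).
Proof. by move=> df; exact: is_deriveN. Qed.

Lemma derB x f g a b : is_derive x 1 f a -> is_derive x 1 g b ->
  is_derive x 1 (fun t => f t - g t) (a - b).
Proof. by move=> df dg; exact: is_deriveB. Qed.

Lemma derM x f g a b : is_derive x 1 f a -> is_derive x 1 g b ->
  is_derive x 1 (fun t => f t * g t) (a * g x + f x * b).
Proof.
move=> df dg; apply: (is_derive_eq (is_deriveM df dg)).
by rewrite addrC [a * _]mulrC.
Qed.

Lemma derZ x f a c : is_derive x 1 f a -> is_derive x 1 (fun t => c * f t) (c * a).
Proof.
by move=> df; apply: is_derive_eq (derM (der_cst x c) df) _; rewrite mul0r add0r.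
Qed.

Lemma derX2 x f a : is_derive x 1 f a -> is_derive x 1 (fun t => f t ^+ 2) (2 * f x * a).
Proof.
move=> df; under eq_fun do rewrite expr2.
by apply: is_derive_eq (derM df df) _; ring.
Qed.

Lemma der_sum (X : finType) (P : pred X) x (f : X -> R -> R) (a : X -> R) :
  (forall i, is_derive x 1 (f i) (a i)) ->
  is_derive x 1 (fun t => \sum_(i | P i) f i t) (\sum_(i | P i) a i).
Proof.
move=> df; have E s : is_derive x 1 (fun t => \sum_(i <- s | P i) f i t) (\sum_(i <- s | P i) a i).
  elim: s => [|i s IH].
    by under eq_fun do rewrite big_nil; rewrite big_nil; exact: der_cst.
  under eq_fun do rewrite big_cons; rewrite big_cons.
  by case: (P i) => //; exact: derD.
exact: E.
Qed.

Lemma der_comp x f g a b : is_derive x 1 f a -> is_derive (f x) 1 g b ->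
  is_derive x 1 (fun t => g (f t)) (b * a).
Proof.
move=> df dg.
have [df1 dg1] : derivable f x 1 /\ derivable g (f x) 1.
  by split; [case: df | case: dg].
apply: DeriveDef.
  apply/derivable1_diffP; apply: (@differentiable_comp _ _ _ _ f g).
    exact/derivable1_diffP.
  exact/derivable1_diffP.
rewrite -derive1E; have -> : (fun t => g (f t)) = g \o f by [].
by rewrite derive1_comp// !derive1E; case: df => _ ->; case: dg => _ ->.
Qed.

Lemma der_id x : is_derive x 1 (fun t => t) (1 : R).
Proof. exact: is_derive_id. Qed.

Lemma der_expR x f a : is_derive x 1 f a ->
  is_derive x 1 (fun t => expR (f t)) (expR (f x) * a).
Proof. by move=> df; apply: der_comp df _; exact: is_derive_expR. Qed.

Lemma der_continuous x f a : is_derive x 1 f a -> {for x, continuous f}.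
Proof. by case=> df _; apply: differentiable_continuous; apply/derivable1_diffP. Qed.

Lemma der_le f (df : R -> R) (T : R) : 0 <= T ->
  (forall t, 0 <= t <= T -> is_derive t 1 f (df t)) ->
  (forall t, 0 <= t <= T -> 0 <= df t) -> f 0 <= f T.
Proof.
move=> T0 Hd Hp.
have [||c cI E] := @MVT_segment R f df 0 T T0.
- by move=> x; rewrite in_itv/= => /andP[/ltW x0 /ltW xT]; apply: Hd; rewrite x0.
- apply: continuous_in_subspaceT => x; rewrite inE/= in_itv/= => xI.
  exact: der_continuous (Hd _ xI).
- rewrite -subr_ge0 E mulr_ge0 ?subr0// Hp//.
Qed.

Lemma der_eq f (T : R) : 0 <= T ->
  (forall t, 0 <= t <= T -> is_derive t 1 f 0) -> f 0 = f T.
Proof.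
move=> T0 Hd; apply/eqP; rewrite eq_le; apply/andP; split.
  by apply: (@der_le f (fun=> 0)).
rewrite -lerN2; apply: (@der_le (fun t => - f t) (fun=> 0)) => // t tT.
by rewrite -oppr0; apply: derN; exact: Hd.
Qed.

End Derivatives.

(** * Exponentials of finite matrices and linear differential equations *)

Section Semigroup.
Local Open Scope classical_set_scope.
Variables (R : realType) (X : finType).
Implicit Types (G A : X -> X -> R) (f : X -> R).

(** Matrices act on observables rather than on laws: for a generator, [expo G t f x] is the
    expectation of [f] at time [t] from [x]. *)
Definition app G f : X -> R := fun x => \sum_y G x y * f y.
Definition expo G (t : R) f : X -> R := app (trans G t) f.

Lemma appD G f g : app G (fun x => f x + g x) = fun x => app G f x + app G g x.
Proof.
by apply/funext => x; rewrite /app -big_split; apply: eq_bigr => y _; rewrite mulrDr.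
Qed.

Lemma appZ G c f : app G (fun x => c * f x) = fun x => c * app G f x.
Proof.
by apply/funext => x; rewrite /app mulr_sumr; apply: eq_bigr => y _; rewrite mulrCA.
Qed.

(** Powers are defined by multiplication on the right; the left recursion is what makes [G] commute
    with its exponential in [trans_comm]. *)
Lemma mxpowfS G k x y : mxpowf G k.+1 x y = \sum_z G x z * mxpowf G k z y.
Proof.
elim: k x y => [|k IH] x y.
  rewrite /= (bigD1 x)//= eqxx mul1r big1 ?addr0; last first.
    by move=> z zx; rewrite eq_sym (negbTE zx) mul0r.
  rewrite (bigD1 y)//= eqxx mulr1 big1 ?addr0// => z zy.
  by rewrite (negbTE zy) mulr0.
transitivity (\sum_z mxpowf G k.+1 x z * G z y) => //.
under eq_bigr do rewrite IH mulr_suml.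
rewrite exchange_big/=; apply: eq_bigr => z _.
rewrite mulr_sumr; apply: eq_bigr => w _; rewrite mulrA; congr (_ * _).
Qed.

Lemma mxpowf_le G : exists2 C, 0 <= C & forall k x y, `|mxpowf G k x y| <= C ^+ k.
Proof.
pose C := \sum_x \sum_y `|G x y|.
have C0 : 0 <= C by apply: sumr_ge0 => x _; apply: sumr_ge0 => y _.
exists C => //; elim=> [|k IH] x y /=.
  by case: (x == y); rewrite ?normr1 ?normr0 ?expr0.
apply: le_trans (ler_norm_sum _ _ _) _.
apply: (@le_trans _ _ (\sum_z C ^+ k * `|G z y|)).
  by apply: ler_sum => z _; rewrite normrM ler_wpM2r.
rewrite -mulr_sumr exprSr ler_wpM2l ?exprn_ge0//.
apply: ler_sum => z _; rewrite (bigD1 y)//= lerDl.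
by apply: sumr_ge0.
Qed.

Definition tcoef G x y k : R := mxpowf G k x y / k`!%:R.

Lemma trans_pseries G t x y : trans G t x y = limn (pseries (tcoef G x y) t).
Proof.
rewrite /trans /pseries; congr (limn (series _)); apply/funext => k.
by rewrite /tcoef [LHS]mulrC [t ^+ k * _]mulrC mulrA.
Qed.

Lemma cvg_tcoef G x y t : cvgn (pseries (tcoef G x y) t).
Proof.
have [C C0 HC] := mxpowf_le G.
apply: normed_cvg; apply: series_le_cvg (@is_cvg_series_exp_coeff R (C * `|t|)).
- by move=> n; exact: normr_ge0.
- by move=> n; rewrite /exp_coeff/= divr_ge0// exprn_ge0// mulr_ge0.
move=> n /=; rewrite /exp_coeff/= /tcoef !normrM normfV normr_nat normrX.
by rewrite exprMn mulrAC ler_wpM2r ?invr_ge0// ler_wpM2r//.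
Qed.

Lemma diffs_tcoef G x y : pseries_diffs (tcoef G x y) =
  fun k => \sum_z tcoef G x z k * G z y.
Proof.
apply/funext => k; rewrite /pseries_diffs /tcoef /= factS natrM invfM.
rewrite mulrCA [_ * (_ / _)]mulrA divff ?pnatr_eq0// mul1r mulr_suml.
by apply: eq_bigr => z _; rewrite mulrAC.
Qed.

Lemma cvg_pseries_sum (c : X -> nat -> R) (g : X -> R) t :
  (forall z, cvgn (pseries (c z) t)) ->
  pseries (fun k => \sum_z c z k * g z) t @ \oo -->
    \sum_z limn (pseries (c z) t) * g z.
Proof.
move=> Hc.
have -> : pseries (fun k => \sum_z c z k * g z) t =
   (fun n => \sum_z (pseries (c z) t n * g z)).
  apply/funext => n; rewrite /pseries /series/=.
  under eq_bigr do rewrite mulr_suml.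
  rewrite exchange_big/=; apply: eq_bigr => z _; rewrite mulr_suml.
  by apply: eq_bigr => k _; ring.
apply: cvg_big => [|z _]; first exact: add_continuous.
by apply: cvgMl; exact: Hc.
Qed.

Lemma der_trans G (t : R) x y :
  is_derive t 1 (fun s => trans G s x y) (\sum_z trans G t x z * G z y).
Proof.
under eq_fun do rewrite trans_pseries.
have cS c : (forall z, cvgn (pseries (c z) (`|t| + 1))) ->
    forall g : X -> R, cvgn (pseries (fun k => \sum_z c z k * g z) (`|t| + 1)).
  by move=> Hc g; apply/cvg_ex; eexists; exact: cvg_pseries_sum.
have H1 z : cvgn (pseries (pseries_diffs (tcoef G x z)) (`|t| + 1)).
  by rewrite diffs_tcoef; apply: cS => w; exact: cvg_tcoef.
have H2 : cvgn (pseries (pseries_diffs (pseries_diffs (tcoef G x y))) (`|t| + 1)).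
  rewrite (_ : pseries_diffs (pseries_diffs _) =
    fun k => \sum_z pseries_diffs (tcoef G x z) k * G z y); first exact: cS.
  apply/funext => k; rewrite {1}/pseries_diffs diffs_tcoef mulr_sumr.
  by apply: eq_bigr => z _; rewrite mulrA.
(* Termwise differentiation asks for convergence of the series and of its first two formal
   derivatives at a point of modulus larger than [|t|]; here that point is [|t| + 1]. *)
have := @pseries_snd_diffs R (tcoef G x y) (`|t| + 1) t (@cvg_tcoef _ _ _ _) (H1 y) H2.
have tt : `|t| < `| `|t| + 1 |.
  by rewrite [ltRHS]ger0_norm ?addr_ge0// ltrDl.
move=> /(_ tt) H; apply: is_derive_eq H _.
rewrite diffs_tcoef; apply: cvg_lim => //.
under eq_bigr do rewrite trans_pseries.
by apply: cvg_pseries_sum => z; exact: cvg_tcoef.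
Qed.

Lemma trans_comm G t x y :
  \sum_z trans G t x z * G z y = \sum_z G x z * trans G t z y.
Proof.
have H1 : pseries (fun k => \sum_z tcoef G x z k * G z y) t @ \oo -->
    \sum_z trans G t x z * G z y.
  under [X in _ --> X]eq_bigr do rewrite trans_pseries.
  by apply: cvg_pseries_sum => z; exact: cvg_tcoef.
have H2 : pseries (fun k => \sum_z tcoef G z y k * G x z) t @ \oo -->
    \sum_z G x z * trans G t z y.
  under [X in _ --> X]eq_bigr do rewrite mulrC trans_pseries.
  by apply: cvg_pseries_sum => z; exact: cvg_tcoef.
have E : (fun k => \sum_z tcoef G x z k * G z y) =
         (fun k => \sum_z tcoef G z y k * G x z).
  apply/funext => k; transitivity (mxpowf G k.+1 x y / k`!%:R).
    by rewrite /= mulr_suml; apply: eq_bigr => z _; rewrite /tcoef mulrAC.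
  rewrite mxpowfS mulr_suml; apply: eq_bigr => z _; rewrite /tcoef.
  by rewrite [G x z * _]mulrC mulrAC.
rewrite E in H1.
by apply: (cvg_unique _ H1 H2).
Qed.

Lemma trans0 G x y : trans G 0 x y = (x == y)%:R.
Proof.
rewrite /trans; apply: cvg_lim => //.
apply: cvg_near_cst; exists 1%N => // n /= n1.
rewrite /series/= (big_ltn n1)/= expr0 fact0 invr1 !mul1r big1_seq ?addr0// => i.
rewrite mem_index_iota => /andP[_ /andP[i0 _]].
by rewrite expr0n; case: i i0 => // i _; rewrite !mul0r.
Qed.

Lemma expo0 G f : expo G 0 f = f.
Proof.
apply/funext => x; rewrite /expo /app (bigD1 x)//= trans0 eqxx mul1r big1 ?addr0//.
by move=> y yx; rewrite trans0 eq_sym (negbTE yx) mul0r.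
Qed.

Lemma expo_comm G t f : expo G t (app G f) = app G (expo G t f).
Proof.
apply/funext => x; rewrite /expo /app.
under eq_bigr do rewrite mulr_sumr.
under [RHS]eq_bigr do rewrite mulr_sumr.
rewrite exchange_big [RHS]exchange_big/=; apply: eq_bigr => y _.
under eq_bigr do rewrite mulrA.
by rewrite -mulr_suml trans_comm mulr_suml; apply: eq_bigr => z _; rewrite mulrA.
Qed.

(** Dynkin's formula in differential form: the expectation of a time-dependent observable changes by
    its generator term plus its time derivative. *)
Lemma der_expo G (t : R) (u : R -> X -> R) (du : X -> R) x :
  (forall y, is_derive t 1 (fun s => u s y) (du y)) ->
  is_derive t 1 (fun s => expo G s (u s) x) (expo G t (fun y => app G (u t) y + du y) x).
Proof.
move=> Hu.
have H y : is_derive t 1 (fun s => trans G s x y * u s y)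
    ((\sum_z trans G t x z * G z y) * u t y + trans G t x y * du y).
  by apply: derM => //; exact: der_trans.
apply: is_derive_eq (der_sum xpredT H) _.
rewrite /expo appD big_split/=; congr (_ + _).
rewrite -/(expo G t (app G (u t)) x) /expo /app.
under eq_bigr do rewrite mulr_suml.
rewrite exchange_big/=; apply: eq_bigr => z _; rewrite mulr_sumr.
by apply: eq_bigr => y _; rewrite mulrA.
Qed.

Lemma der_expo_cst G (t : R) f x :
  is_derive t 1 (fun s => expo G s f x) (expo G t (app G f) x).
Proof.
apply: is_derive_eq (der_expo (u := fun=> f) (du := fun=> 0) G x _) _.
  by move=> y; exact: der_cst.
by congr (expo _ _ _ _); apply/funext => y; rewrite addr0.
Qed.

(** The interpolation [exp ((T - t) G) (u t)] joins the two sides and has zero derivative in [t]. *)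
Lemma expo_unique G (u : R -> X -> R) (T : R) : 0 <= T ->
  (forall t x, 0 <= t <= T -> is_derive t 1 (fun s => u s x) (app G (u t) x)) ->
  u T = expo G T (u 0).
Proof.
move=> T0 Hu; apply/funext => x.
pose v t := expo G (T - t) (u t) x.
have v0 : v 0 = expo G T (u 0) x by rewrite /v subr0.
have vT : v T = u T x by rewrite /v subrr expo0.
rewrite -v0 -vT; apply/esym/der_eq => // t tT.
have H y : is_derive t 1 (fun s => trans G (T - s) x y * u s y)
   ((\sum_z trans G (T - t) x z * G z y) * -1 * u t y +
    trans G (T - t) x y * app G (u t) y).
  apply: derM; last exact: Hu.
  have dT : is_derive t 1 (fun s => T - s) (- (1 : R)).
    by rewrite -[- 1]add0r; exact: derB (der_cst _ _) (der_id _).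
  exact: der_comp dT (der_trans _ _ _ _).
apply: is_derive_eq (der_sum xpredT H) _.
rewrite big_split/= -[X in _ + X]/(expo G (T - t) (app G (u t)) x).
rewrite (_ : \sum_(i : X) _ = - expo G (T - t) (app G (u t)) x) ?addNr//.
rewrite /expo /app -sumrN.
rewrite sumrN; transitivity (- \sum_y \sum_z trans G (T - t) x z * G z y * u t y).
  by rewrite -sumrN; apply: eq_bigr => y _; rewrite mulrN1 mulNr mulr_suml.
congr (- _); rewrite exchange_big/=; apply: eq_bigr => z _; rewrite mulr_sumr.
by apply: eq_bigr => y _; rewrite mulrA.
Qed.

(** No jump leads out of [D]. The joint chain also contains pairs whose action is not the Whittle
    action; the estimates for the Whittle policy hold only on the closed set of the remaining
    pairs. *)
Definition closed_under G (D : pred X) := forall x y, D x -> ~~ D y -> G x y = 0.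

Lemma trans_closed G D t : closed_under G D -> closed_under (trans G t) D.
Proof.
move=> HD x y Dx Dy.
have H k : mxpowf G k x y = 0.
  elim: k y Dy => [|k IH] y Dy /=.
    by case: eqP Dy => // <-; rewrite Dx.
  apply: big1 => z _; case Dz: (D z); first by rewrite HD ?mulr0.
  by rewrite IH ?mul0r ?Dz.
rewrite /trans (_ : series _ = fun=> 0); first exact: lim_cst.
by apply/funext => n; rewrite /series/= big1// => k _; rewrite H mulr0.
Qed.

End Semigroup.

(** * Markov semigroups: positivity, conservation of mass, monotonicity *)

Section Generator.
Local Open Scope classical_set_scope.
Variables (R : realType) (X : finType) (G : X -> X -> R).

Definition generator := (forall x y, x != y -> 0 <= G x y) /\ forall x, \sum_y G x y = 0.
Hypothesis genG : generator.

Lemma app_generator f x : app G f x = \sum_(y | y != x) G x y * (f y - f x).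
Proof.
rewrite /app (bigD1 x)//=; under [RHS]eq_bigr do rewrite mulrBr.
have := genG.2 x; rewrite (bigD1 x)//= => /eqP; rewrite addr_eq0 => /eqP ->.
by rewrite sumrB -mulr_suml mulNr addrC.
Qed.

Lemma app_cst c : app G (fun=> c) = fun=> 0.
Proof. by apply/funext => x; rewrite /app -mulr_suml genG.2 mul0r. Qed.

Lemma expo_harmonic u t : 0 <= t -> app G u = (fun=> 0) -> expo G t u = u.
Proof.
move=> t0 Hu; apply/esym; apply: (@expo_unique _ _ G (fun=> u) t t0) => s x _.
by rewrite Hu; exact: der_cst.
Qed.

(* With [lam] large, [G + lam] is entrywise nonnegative and
   [exp (t G) = exp (- lam t) exp (t (G + lam))]. *)
Lemma trans_ge0 t x y : 0 <= t -> 0 <= trans G t x y.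
Proof.
move=> t0; pose lam := \sum_z `|G z z|.
pose A x y := G x y + lam * (x == y)%:R.
have A0 a b : 0 <= A a b.
  rewrite /A; have [<-|ab] := eqVneq a b; last by rewrite mulr0 addr0 genG.1.
  rewrite mulr1 -lerBlDl sub0r; apply: le_trans (ler_norm _) _.
  by rewrite normrN /lam (bigD1 a)//= lerDl sumr_ge0.
have TA0 : 0 <= trans A t x y.
  apply: limr_ge.
    move: (@cvg_tcoef _ _ A x y t); rewrite /pseries.
    rewrite (_ : (fun i => tcoef A x y i * t ^+ i) =
                 (fun k => t ^+ k / k`!%:R * mxpowf A k x y))//.
    by apply/funext => k; rewrite /tcoef mulrC; ring.
  near=> n; apply: sumr_ge0 => k _; apply: mulr_ge0.
    by rewrite divr_ge0// exprn_ge0.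
  elim: k y => [|k IH] y0 /=; first by case: (_ == _).
  by apply: sumr_ge0 => z _; apply: mulr_ge0.
pose f z : R := (z == y)%:R.
have pick H s : expo H s f x = trans H s x y.
  rewrite /expo /app (bigD1 y)//= /f eqxx mulr1 big1 ?addr0// => z zy.
  by rewrite (negbTE zy) mulr0.
have appA g z : app A g z = app G g z + lam * g z.
  rewrite /app /A; under eq_bigr do rewrite mulrDl; rewrite big_split/=; congr (_ + _).
  rewrite (bigD1 z)//= eqxx mulr1 big1 ?addr0// => w wz.
  by rewrite eq_sym (negbTE wz) mulr0 mul0r.
pose u s z := expR (- (lam * s)) * expo A s f z.
have u0 : u 0 = f by apply/funext => z; rewrite /u mulr0 oppr0 expR0 mul1r expo0.
have E : u t = expo G t f.
  rewrite -u0; apply: (@expo_unique _ _ G u t t0) => s z _.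
  have dl : is_derive s 1 (fun r => - (lam * r)) (- (lam * 1)).
    by apply: derN; apply: derZ; exact: der_id.
  apply: is_derive_eq (derM (der_expR dl) (der_expo_cst A s f z)) _.
  by rewrite expo_comm appA /u appZ; ring.
by rewrite -pick -E mulr_ge0 ?expR_ge0// pick.
Unshelve. all: by end_near. Qed.

Lemma trans_sum1 t x : 0 <= t -> \sum_y trans G t x y = 1.
Proof.
move=> t0; have := expo_harmonic t0 (app_cst 1).
move=> /(congr1 (fun h => h x)) <-.
by apply: eq_bigr => y _; rewrite mulr1.
Qed.

Lemma expo_mono D t f g x : closed_under G D -> 0 <= t -> D x ->
  (forall y, D y -> f y <= g y) -> expo G t f x <= expo G t g x.
Proof.
move=> HD t0 Dx fg; apply: ler_sum => y _; case Dy: (D y).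
  by rewrite ler_wpM2l ?trans_ge0 ?fg.
by rewrite (trans_closed t HD) ?mul0r ?Dy.
Qed.

Lemma expo_cst t c x : 0 <= t -> expo G t (fun=> c) x = c.
Proof. by move=> t0; rewrite /expo /app -mulr_suml trans_sum1// mul1r. Qed.

End Generator.

(** * Long-run averages *)

Section LongRunAverage.
Local Open Scope classical_set_scope.
Variables (R : realType) (X : finType) (G : X -> X -> R).
Hypothesis genG : generator G.
Implicit Types (f g u w mu : X -> R).

Lemma expo_bounded f t x : 0 <= t -> `|expo G t f x| <= \sum_y `|f y|.
Proof.
move=> t0.
have D1 : closed_under G xpredT by [].
have fM y : `|f y| <= \sum_z `|f z| by rewrite (bigD1 y)//= lerDl sumr_ge0.
rewrite ler_norml; apply/andP; split.
  rewrite -(expo_cst genG (- \sum_z `|f z|) x t0).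
  by apply: (expo_mono genG D1) => // y _; rewrite lerNl (le_trans (ler_norm _))// normrN.
rewrite -[leRHS](expo_cst genG _ x t0).
by apply: (expo_mono genG D1) => // y _; rewrite (le_trans (ler_norm _)).
Qed.

(* If [G v = u] and [G u = 0] then [exp (t G) v = v + t u], which is bounded. *)
Lemma ker_range_generator u v : app G v = u -> app G u = (fun=> 0) -> u = (fun=> 0).
Proof.
move=> Gv Gu; apply/funext => x.
have E t : 0 <= t -> v x + t * u x = expo G t v x.
  move=> t0; pose y (s : R) z := v z + s * u z.
  have y0 : y 0 = v by apply/funext => z; rewrite /y mul0r addr0.
  suff -> : expo G t v = y t by [].
  rewrite -y0; apply/esym; apply: (@expo_unique _ _ G y t t0) => s z _.
  rewrite /y appD appZ Gv Gu mulr0 addr0.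
  have := derD (der_cst s (v z)) (derM (der_id s) (der_cst s (u z))).
  by move=> H; apply: is_derive_eq H _; rewrite add0r mul1r mulr0 addr0.
apply/eqP; rewrite -normr_le0 leNgt; apply/negP => u0.
pose M := \sum_y `|v y|.
have M0 : 0 <= M by exact: sumr_ge0.
(* At this time [t |u x|] is [2 M + 1], more than the [2 M] that boundedness of [exp (t G) v]
   allows. *)
have t0 : 0 <= (2 * M + 1) / `|u x| by rewrite divr_ge0 ?addr_ge0 ?mulr_ge0.
have B := expo_bounded v x t0; rewrite -E// -/M in B.
have vM : `|v x| <= M by rewrite /M (bigD1 x)//= lerDl sumr_ge0.
have : `|(2 * M + 1) / `|u x| * u x| <= 2 * M.
  rewrite -[X in `|X|](addKr (v x)) addrC; apply: le_trans (ler_normD _ _) _.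
  by rewrite normrN; lra.
rewrite normrM ger0_norm// divfK ?gt_eqF//; lra.
Qed.

(** Kernel and range of [G] meet only in 0 by [ker_range_generator], and their dimensions add up to
    that of the whole space. In Markov terms, [u x] is the long-run average of [f] from [x] and [w]
    solves a Poisson equation. *)
Lemma poisson_decomposition f :
  exists u w, app G u = (fun=> 0) /\ f = (fun x => u x + app G w x).
Proof.
pose V := {ffun X -> R^o}.
pose L (v : V) : V := [ffun x => app G v x].
have Llin : linear L.
  move=> a v w; apply/ffunP => x; rewrite !ffunE /app.
  under eq_bigr do rewrite !ffunE mulrDr.
  rewrite big_split/=; congr (_ + _).
  by rewrite /GRing.scale/= mulr_sumr; apply: eq_bigr => y _; rewrite mulrCA.
pose LL : {linear V -> V} := HB.pack L (GRing.isLinear.Build _ _ _ _ L Llin).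
pose h : 'End(V) := linfun LL.
have hE v : h v = L v by rewrite lfunE.
have cap0 : (lker h :&: limg h)%VS = 0%VS.
  apply/eqP; rewrite -subv0; apply/subvP => v; rewrite memv_cap memv0 => /andP[].
  rewrite memv_ker hE => /eqP Lv /memv_imgP[w _]; rewrite hE => vE.
  have := @ker_range_generator v w.
  have -> : app G w = v by apply/funext => x; rewrite vE ffunE.
  have -> : app G v = (fun=> 0).
    by apply/funext => x; have /ffunP/(_ x) := Lv; rewrite !ffunE.
  by move=> /(_ erefl erefl) v0; apply/eqP/ffunP => x; rewrite v0 ffunE.
have full : (lker h + limg h)%VS = fullv.
  apply/eqP; rewrite eqEdim subvf/= -(limg_ker_dim h fullv) capfv addnC.
  by have := dimv_sum_cap (lker h) (limg h); rewrite cap0 dimv0 addn0 addnC => ->.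
have : [ffun x => f x] \in (lker h + limg h)%VS by rewrite full memvf.
move=> /memv_addP[u uk [v /memv_imgP[w _ ->] E]].
exists u, w; split.
  move: uk; rewrite memv_ker hE => /eqP /ffunP uk.
  by apply/funext => x; have := uk x; rewrite !ffunE.
apply/funext => x; have /ffunP/(_ x) := E.
by rewrite !ffunE hE ffunE.
Qed.

Lemma exp_cumE mu u w (T : R) : app G u = (fun=> 0) -> 0 < T ->
  exp_cum G mu (fun x => u x + app G w x) T =
  T * (\sum_x mu x * u x) + \sum_x mu x * (expo G T w x - w x).
Proof.
move=> Gu T0; pose f x := u x + app G w x.
rewrite /exp_cum -/f.
pose h (t : R) := \sum_(x : X) \sum_(y : X) mu x * trans G t x y * f y.
have hE t : h t = \sum_x mu x * expo G t f x.
  apply: eq_bigr => x _; rewrite /expo /app mulr_sumr.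
  by apply: eq_bigr => y _; rewrite mulrA.
have hc : continuous h.
  move=> t; rewrite (_ : h = fun s => \sum_x mu x * expo G s f x); last exact/funext.
  apply: der_continuous; apply: der_sum => x; apply: derZ; exact: der_expo_cst.
(* An explicit antiderivative: [u] is invariant under the semigroup, and the expectation of
   [app G w] is the time derivative of that of [w]. *)
pose Y t := \sum_x mu x * (t * u x + expo G t w x).
have dY (t : R) : 0 <= t -> is_derive t 1 Y (h t).
  move=> t0; rewrite hE; apply: der_sum => x; apply: derZ.
  rewrite /f {2}/expo appD -/(expo G t u) -/(expo G t (app G w)).
  rewrite (expo_harmonic t0 Gu); apply: derD; last exact: der_expo_cst.
  by have := derM (der_id t) (der_cst t (u x)); rewrite mul1r mulr0 addr0.
have -> : \int[lebesgue_measure]_(t in `[0, T]) h t = Y T - Y 0.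
  rewrite /Rintegral (continuous_FTC2 (F := Y) T0)//.
  - exact: continuous_subspaceT.
  - have cY (t : R) : 0 <= t -> {for t, continuous Y} by move=> t0; exact: der_continuous (dY t t0).
    split.
    + by move=> t; rewrite in_itv/= => /andP[/ltW/dY[]].
    + by apply: cvg_at_right_filter; apply: cY.
    + by apply: cvg_at_left_filter; apply: cY; exact: ltW.
  - by move=> t; rewrite in_itv/= => /andP[/ltW/dY[_ <-] _]; rewrite derive1E.
rewrite /Y -sumrB mulr_sumr -big_split/=; apply: eq_bigr => x _.
by rewrite expo0; ring.
Qed.

(** In [exp_cumE] the contribution of [w] stays bounded in [T], so it disappears after division by
    [T]. *)
Lemma lr_avgE mu u w : app G u = (fun=> 0) ->
  lr_avg G mu (fun x => u x + app G w x) = \sum_x mu x * u x.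
Proof.
move=> Gu; apply: cvg_lim => //.
pose C := \sum_x `|mu x| * (2 * \sum_y `|w y|).
have C0 : 0 <= C.
  by apply: sumr_ge0 => x _; rewrite !mulr_ge0// sumr_ge0.
apply/cvgrPdist_le => e e0; near=> T.
have T0 : 0 < T by near: T; exact: nbhs_pinfty_gt.
have CT : C / e <= T by near: T; apply: nbhs_pinfty_ge; exact: num_real.
rewrite exp_cumE// mulrDl mulrAC divff ?gt_eqF// mul1r opprD addrA subrr add0r.
rewrite normrN normrM normfV (gtr0_norm T0) ler_pdivrMr//.
move: CT; rewrite ler_pdivrMr// mulrC => /(le_trans _); apply.
apply: le_trans (ler_norm_sum _ _ _) _; apply: ler_sum => x _.
rewrite normrM ler_wpM2l//; apply: le_trans (ler_normB _ _) _.
have := expo_bounded w x (ltW T0).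
have : `|w x| <= \sum_y `|w y| by rewrite (bigD1 x)//= lerDl sumr_ge0.
lra.
Unshelve. all: by end_near. Qed.

Lemma lr_avgD mu f g :
  lr_avg G mu (fun x => f x + g x) = lr_avg G mu f + lr_avg G mu g.
Proof.
have [u [w [Gu ->]]] := poisson_decomposition f.
have [v [z [Gv ->]]] := poisson_decomposition g.
have -> : (fun x => u x + app G w x + (v x + app G z x)) =
  (fun x => (u x + v x) + app G (fun x => w x + z x) x).
  by apply/funext => x; rewrite appD addrACA.
have Guv : app G (fun x => u x + v x) = (fun=> 0).
  by rewrite appD Gu Gv; apply/funext => x; rewrite addr0.
rewrite !lr_avgE//.
by rewrite -big_split; apply: eq_bigr => x _; rewrite mulrDr.
Qed.

Lemma lr_avgZ mu c f : lr_avg G mu (fun x => c * f x) = c * lr_avg G mu f.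
Proof.
have [u [w [Gu ->]]] := poisson_decomposition f.
have -> : (fun x => c * (u x + app G w x)) =
  (fun x => c * u x + app G (fun x => c * w x) x).
  by apply/funext => x; rewrite appZ mulrDr.
have Gcu : app G (fun x => c * u x) = (fun=> 0).
  by rewrite appZ Gu; apply/funext => x; rewrite mulr0.
rewrite !lr_avgE//.
by rewrite mulr_sumr; apply: eq_bigr => x _; rewrite mulrCA.
Qed.

Lemma lr_avg_cst mu c : \sum_x mu x = 1 -> lr_avg G mu (fun=> c) = c.
Proof.
move=> mu1; have := @lr_avgE mu (fun=> c) (fun=> 0) (app_cst genG c).
rewrite -mulr_suml mu1 mul1r => {2}<-; congr (lr_avg _ _ _).
by apply/funext => x; rewrite app_cst// addr0.
Qed.

Lemma lr_avg_app mu w : lr_avg G mu (app G w) = 0.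
Proof.
have := @lr_avgE mu (fun=> 0) w (app_cst genG 0).
rewrite big1 ?addr0 => [<-|x _]; last by rewrite mulr0.
by congr (lr_avg _ _ _); apply/funext => x; rewrite add0r.
Qed.

(** The semigroup fixes [u] and maps [app G w] to another element of the range. Through this lemma a
    bound on [exp (T G) f] at a single time controls the long-run average of [f]. *)
Lemma lr_avg_expo mu f t : 0 <= t -> lr_avg G mu (expo G t f) = lr_avg G mu f.
Proof.
move=> t0; have [u [w [Gu ->]]] := poisson_decomposition f.
rewrite /expo appD -/(expo G t u) -/(expo G t (app G w)).
by rewrite (expo_harmonic t0 Gu) expo_comm !lr_avgE.
Qed.

(** The function [t u x + exp (t G) w x] is nondecreasing in [t], its derivative being the
    expectation of [f]. A negative [u x] would send it to minus infinity, since the term in [w] is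
    bounded. *)
Lemma lr_avg_ge0 (D : pred X) mu f : closed_under G D ->
  (forall x, 0 <= mu x) -> (forall x, ~~ D x -> mu x = 0) ->
  (forall x, D x -> 0 <= f x) -> 0 <= lr_avg G mu f.
Proof.
move=> HD mu0 muD f0; have [u [w [Gu fE]]] := poisson_decomposition f.
rewrite fE lr_avgE//; apply: sumr_ge0 => x _.
case Dx: (D x); last by rewrite muD ?mul0r ?Dx.
apply: mulr_ge0 => //; rewrite leNgt; apply/negP => ux.
pose M := \sum_y `|w y|.
have M0 : 0 <= M by exact: sumr_ge0.
have wM : `|w x| <= M by rewrite /M (bigD1 x)//= lerDl sumr_ge0.
pose T := (2 * M + 1) / - u x.
have T0 : 0 <= T by rewrite divr_ge0 ?addr_ge0 ?mulr_ge0// oppr_ge0 ltW.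
have := @der_le R (fun t => t * u x + expo G t w x) (fun t => expo G t f x) T T0.
rewrite mul0r add0r expo0 => H.
have {H} : w x <= T * u x + expo G T w x.
  apply: H => t /andP[t0 _].
    rewrite fE {2}/expo appD -/(expo G t u) -/(expo G t (app G w)).
    rewrite (expo_harmonic t0 Gu); apply: derD; last exact: der_expo_cst.
    by have := derM (der_id t) (der_cst t (u x)); rewrite mul1r mulr0 addr0.
  rewrite -(expo_cst genG 0 x t0); exact: (expo_mono genG HD).
have -> : T * u x = - (2 * M + 1).
  by rewrite /T invrN mulrN mulNr divfK// lt_eqF.
have := expo_bounded w x T0; rewrite -/M !ler_norml in wM *.
by move: wM => /andP[? ?] /andP[? ?]; lra.
Qed.

Lemma lr_avg_mono (D : pred X) mu f g : closed_under G D ->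
  (forall x, 0 <= mu x) -> (forall x, ~~ D x -> mu x = 0) ->
  (forall x, D x -> f x <= g x) -> lr_avg G mu f <= lr_avg G mu g.
Proof.
move=> HD mu0 muD fg.
have := @lr_avg_ge0 D mu (fun x => g x + -1 * f x) HD mu0 muD.
rewrite lr_avgD lr_avgZ mulN1r subr_ge0; apply=> x Dx.
by rewrite mulN1r subr_ge0 fg.
Qed.

End LongRunAverage.

(** * The subsidized single bandit *)

Section Irreducible.
Local Open Scope classical_set_scope.
Variables (R : realType) (X : finType) (G : X -> X -> R).
Hypothesis genG : generator G.
Hypothesis irrG : forall x y, connect [rel k l : X | 0 < G k l] x y.
Implicit Types (f u w : X -> R).

(** Maximum principle: at a maximum point [k] all differences [w y - w k] are nonpositive, so
    [0 <= app G w k] forces equality along every positive rate, and irreducibility carries the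
    equality to all states. *)
Lemma subharmonic_constant w : (forall x, 0 <= app G w x) -> forall x y, w x = w y.
Proof.
move=> Gw x0; pose m := [arg max_(x > x0) w x]%O.
have wm y : w y <= w m by rewrite /m; case: arg_maxP => // i _; apply.
have step k l : w k = w m -> 0 < G k l -> w l = w m.
  move=> km kl; have [->//|lk] := eqVneq l k; rewrite -km.
  have wk y : w y <= w k by rewrite km.
  have := Gw k; rewrite app_generator// (bigD1 l)//= => H.
  have : \sum_(y | (y != k) && (y != l)) G k y * (w y - w k) <= 0.
    apply: sumr_le0 => y /andP[yk _]; rewrite mulr_ge0_le0// ?subr_le0//.
    by rewrite genG.1 1?eq_sym.
  move=> H2; apply/eqP; rewrite eq_le wk/= -subr_ge0 -(pmulr_rge0 _ kl); lra.
have all y : w y = w m.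
  have /connectP[p] := irrG m y.
  have: w m = w m by []; move: {1 3 4}m => z.
  elim: p z => [|z' p IH] z /= zm; first by move=> _ ->.
  by move=> /andP[zz' pp] yE; apply: IH pp yE; exact: step zz'.
by move=> y; rewrite !all.
Qed.

Lemma harmonic_constant u : app G u = (fun=> 0) -> forall x y, u x = u y.
Proof. by move=> Gu; apply: subharmonic_constant => x; rewrite Gu. Qed.

Lemma subharmonic_app0 w : (forall x, 0 <= app G w x) -> app G w = (fun=> 0).
Proof.
move=> /subharmonic_constant wc; apply/funext => x.
by rewrite app_generator// big1// => y _; rewrite (wc y x) subrr mulr0.
Qed.

Definition point_mass (x0 x : X) : R := (x == x0)%:R.

Lemma point_mass_sum x0 u : \sum_x point_mass x0 x * u x = u x0.
Proof.
rewrite (bigD1 x0)//= /point_mass eqxx mul1r big1 ?addr0// => x xx0.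
by rewrite (negbTE xx0) mul0r.
Qed.

Lemma point_mass_sum1 x0 : \sum_x point_mass x0 x = 1.
Proof. by rewrite -[RHS](point_mass_sum x0 (fun=> 1)); apply: eq_bigr => x _; rewrite mulr1. Qed.

Lemma irreducible_poisson f : exists w, forall x0,
  f = (fun x => lr_avg G (point_mass x0) f + app G w x).
Proof.
have [u [w [Gu fE]]] := poisson_decomposition genG f.
exists w => x0; rewrite {2}fE lr_avgE// point_mass_sum {1}fE.
by apply/funext => x; rewrite (harmonic_constant Gu x x0).
Qed.

(** If the average [c] were nonpositive, [app G w = f - c] would be nonnegative, hence zero by the
    maximum principle, and [f] would be the constant [c]. *)
Lemma lr_avg_gt0 f x0 x1 : (forall x, 0 <= f x) -> 0 < f x1 ->
  0 < lr_avg G (point_mass x0) f.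
Proof.
move=> f0 f1; have [w /(_ x0) fE] := irreducible_poisson f.
rewrite ltNge; apply/negP => c0.
have Gw x : 0 <= app G w x.
  by have := f0 x; rewrite fE => ?; rewrite (le_trans (y := lr_avg G (point_mass x0) f + app G w x))// gerDr.
have := congr1 (fun h => h x1) fE; rewrite subharmonic_app0// addr0 => f1E.
by move: f1; rewrite f1E ltNge c0.
Qed.

End Irreducible.

(** * Gains, Whittle indices and the Bellman equation *)

Section Subsidy.
Local Open Scope classical_set_scope.
Variables (R : realType) (d : nat) (Q : bool -> 'I_d -> 'I_d -> R).
Variable Rw : bool -> 'I_d -> R.
Hypothesis genQ : forall a, is_generator (Q a).
Hypothesis uniQ : unichain Q.
Implicit Types (nu : R) (pol : 'I_d -> bool) (i j : 'I_d).

Definition policy_gen pol i j := Q (pol i) i j.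
Definition sub_reward nu (a : bool) i := Rw a i + (if a then 0 else nu).

Lemma generator_policy pol : generator (policy_gen pol).
Proof.
split=> [i j ij|i]; first by have [H _] := genQ (pol i); exact: H.
by have [_ H] := genQ (pol i); exact: H.
Qed.

Lemma sub_gainE nu pol i : sub_gain Q Rw nu pol i =
  lr_avg (policy_gen pol) (point_mass R i) (fun k => sub_reward nu (pol k) k).
Proof. by []. Qed.

Lemma sub_gain_poisson nu pol : exists h, forall i k,
  sub_reward nu (pol k) k = sub_gain Q Rw nu pol i + app (policy_gen pol) h k.
Proof.
have [w H] := irreducible_poisson (generator_policy pol) (uniQ pol)
  (fun k => sub_reward nu (pol k) k).
by exists w => i k; have := congr1 (fun h => h k) (H i).
Qed.

Lemma sub_gain_cst nu pol i j : sub_gain Q Rw nu pol i = sub_gain Q Rw nu pol j.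
Proof.
have [h H] := sub_gain_poisson nu pol.
by apply: (addIr (app (policy_gen pol) h i)); rewrite -!H.
Qed.

(** The long-run fraction of passive time, which is the slope of the gain as a function of the
    subsidy. *)
Definition passivity pol i :=
  lr_avg (policy_gen pol) (point_mass R i) (fun k => (~~ pol k)%:R).

Lemma sub_gain_affine nu pol i :
  sub_gain Q Rw nu pol i = sub_gain Q Rw 0 pol i + nu * passivity pol i.
Proof.
rewrite !sub_gainE /passivity -(lr_avgZ (generator_policy pol)).
rewrite -(lr_avgD (generator_policy pol)); congr lr_avg; apply/funext => k.
by rewrite /sub_reward; case: (pol k); rewrite ?mulr0 ?mulr1 !addr0.
Qed.

Lemma passivity_gt0 pol i k : pol k = false -> 0 < passivity pol i.
Proof.
move=> pk; apply: (lr_avg_gt0 (generator_policy pol) (uniQ pol) i (x1 := k)).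
  by move=> x; exact: ler0n.
by rewrite pk ltr01.
Qed.

Lemma passivityC pol i : 1 - passivity pol i =
  lr_avg (policy_gen pol) (point_mass R i) (fun k => (pol k)%:R).
Proof.
rewrite -[X in X - _](lr_avg_cst (generator_policy pol) 1 (point_mass_sum1 R i)).
rewrite -mulN1r -(lr_avgZ (generator_policy pol)) -(lr_avgD (generator_policy pol)).
by congr lr_avg; apply/funext => k; case: (pol k); rewrite ?mulr0 ?mulr1 ?addr0 ?subrr.
Qed.

Lemma passivity_lt1 pol i k : pol k = true -> passivity pol i < 1.
Proof.
move=> pk; rewrite -subr_gt0 passivityC.
apply: (lr_avg_gt0 (generator_policy pol) (uniQ pol) i (x1 := k)).
  by move=> x; exact: ler0n.
by rewrite pk ltr01.
Qed.

Lemma passivity_bounds pol i : 0 <= passivity pol i <= 1.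
Proof.
have nneg f : (forall k, 0 <= f k) -> 0 <= lr_avg (policy_gen pol) (point_mass R i) f.
  by move=> f0; apply: (lr_avg_ge0 (generator_policy pol) (D := xpredT)) => //.
apply/andP; split; first by apply: nneg => k; exact: ler0n.
by rewrite -subr_ge0 passivityC; apply: nneg => k; exact: ler0n.
Qed.

Lemma sub_gain_all_active nu i :
  sub_gain Q Rw nu xpredT i = sub_gain Q Rw 0 xpredT i.
Proof. by []. Qed.

Lemma sub_gain_all_passive nu i :
  sub_gain Q Rw nu pred0 i = sub_gain Q Rw 0 pred0 i + nu.
Proof.
rewrite sub_gain_affine; congr (_ + _); rewrite -[RHS]mulr1; congr (_ * _).
exact: (lr_avg_cst (generator_policy pred0) 1 (point_mass_sum1 R i)).
Qed.

Lemma finfun_policy pol : (finfun pol : 'I_d -> bool) = pol.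
Proof. by apply/funext => i; rewrite ffunE. Qed.

(** The gain does not depend on the initial state, so a best policy for one state, among finitely
    many, is best for all. *)
Lemma sub_optimal_exists nu i : exists pol, sub_optimal Q Rw nu pol.
Proof.
pose p0 : {ffun 'I_d -> bool} := [ffun=> true].
pose m := [arg max_(p > p0) (sub_gain Q Rw nu p i)]%O.
exists m => pol j; rewrite -(finfun_policy pol) !(sub_gain_cst nu _ j i).
by rewrite /m; case: arg_maxP => // p _; apply.
Qed.

Lemma sub_gain_lipschitz nu nu' pol i :
  `|sub_gain Q Rw nu pol i - sub_gain Q Rw nu' pol i| <= `|nu - nu'|.
Proof.
rewrite (sub_gain_affine nu) (sub_gain_affine nu') opprD addrACA subrr add0r.
rewrite -mulrBl normrM; have /andP[p0 p1] := passivity_bounds pol i.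
by rewrite -[leRHS]mulr1 ler_wpM2l// ger0_norm.
Qed.

(* There are finitely many policies and their gains are affine in the subsidy. *)
Lemma sub_optimal_closed (P : ('I_d -> bool) -> Prop) nu i :
  (forall e, 0 < e -> exists nu' pol,
     [/\ `|nu - nu'| < e, sub_optimal Q Rw nu' pol & P pol]) ->
  exists pol, sub_optimal Q Rw nu pol /\ P pol.
Proof.
move=> H; apply: contrapT => /forallNP N.
have [m mopt] := sub_optimal_exists nu i.
pose gap pol := sub_gain Q Rw nu m i - sub_gain Q Rw nu pol i.
have gap_gt0 pol : P pol -> 0 < gap pol.
  move=> Pp; rewrite lt_neqAle subr_ge0 mopt andbT eq_sym subr_eq0.
  apply/negP => /eqP E; apply: (N pol); split=> // pol' j.
  by rewrite (sub_gain_cst nu pol j i) -E (sub_gain_cst nu pol' j i).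
(* Half the least gap over the policies in [P], capped at 1. Each gain moves by at most
   [|nu - nu'| < e], too little for a policy in [P] to catch up with [m]. *)
pose e := \big[Num.min/1]_(p : {ffun 'I_d -> bool} | `[<P p>]) (gap p / 2).
have e0 : 0 < e.
  apply: (big_ind (fun x => 0 < x)) => //; first by move=> x y x0 y0; rewrite lt_min x0.
  by move=> p /asboolP/gap_gt0 ?; rewrite divr_gt0.
have [nu' [pol [nn opt Pp]]] := H e e0.
have eg : e <= gap pol / 2.
  rewrite /e -(finfun_policy pol) in Pp *.
  by apply: (@bigmin_le_cond _ _ _ _ (finfun pol)); apply/asboolP.
have := opt m i.
have := sub_gain_lipschitz nu nu' pol i; have := sub_gain_lipschitz nu nu' m i.
rewrite !ler_norml => /andP[? ?] /andP[? ?] ?.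
by move: nn eg; rewrite /gap; lra.
Qed.

(** Policy improvement, with [h] the bias of an optimal policy [m]. If the inequality failed at
    [(a, i)], using [a] in state [i] would make the difference of two biases subharmonic, hence
    constant, and the new gain would exceed [g]. Conversely, along any optimal policy the inequality
    makes such a difference subharmonic, so it is an equality in every state. *)
Lemma bellman nu (i0 : 'I_d) : exists g h,
  (forall a i, sub_reward nu a i + \sum_j Q a i j * h j <= g) /\
  (forall pol i, sub_optimal Q Rw nu pol ->
     sub_reward nu (pol i) i + \sum_j Q (pol i) i j * h j = g).
Proof.
have [m mopt] := sub_optimal_exists nu i0.
have [w wE] := sub_gain_poisson nu m.
pose h j := - w j; pose g := sub_gain Q Rw nu m i0.
have appN pol u v k : app (policy_gen pol) (fun j => u j + -1 * v j) k =
    app (policy_gen pol) u k - app (policy_gen pol) v k.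
  by rewrite appD appZ mulN1r.
have apph a pol k : pol k = a -> \sum_j Q a k j * h j = - app (policy_gen pol) w k.
  by move=> <-; rewrite /app -sumrN; apply: eq_bigr => j _; rewrite mulrN.
have hE k : sub_reward nu (m k) k + \sum_j Q (m k) k j * h j = g.
  by rewrite (apph _ m)// (wE i0) addrK.
have ineq a i : sub_reward nu a i + \sum_j Q a i j * h j <= g.
  rewrite leNgt; apply/negP => bad.
  pose p k := if k == i then a else m k.
  have pi : p i = a by rewrite /p eqxx.
  have Hp k : g <= sub_reward nu (p k) k - app (policy_gen p) w k.
    have := apph (p k) p k erefl; rewrite /= => <-.
    by rewrite /p; case: eqP => [->|_]; [exact: ltW | rewrite hE].
  have [z zE] := sub_gain_poisson nu p.
  have pm : sub_gain Q Rw nu p i0 <= g by exact: mopt.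
  have := @subharmonic_app0 _ _ _ (generator_policy p) (uniQ p) (fun k => z k + -1 * w k).
  have sub k : 0 <= app (policy_gen p) (fun k => z k + -1 * w k) k.
    by rewrite appN; have := Hp k; rewrite (zE i0); lra.
  move=> /(_ sub) /(congr1 (fun f => f i)); rewrite appN => E.
  by move: bad; rewrite (apph a p)// -pi (zE i0); lra.
exists g, h; split=> // pol i popt.
have polg : sub_gain Q Rw nu pol i0 = g by apply/le_anti; rewrite popt mopt.
have [z zE] := sub_gain_poisson nu pol.
have := @subharmonic_app0 _ _ _ (generator_policy pol) (uniQ pol) (fun k => w k + -1 * z k).
have sub k : 0 <= app (policy_gen pol) (fun k => w k + -1 * z k) k.
  rewrite appN; have := ineq (pol k) k; rewrite (apph _ pol)// (zE i0) polg; lra.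
move=> /(_ sub) /(congr1 (fun f => f i)); rewrite appN => E.
by rewrite (apph _ pol)// (zE i0) polg; lra.
Qed.

(** Comparison with the policy that is always active: a policy passive in [i] has positive
    passivity, so its optimality bounds [nu] from below, and there are finitely many policies.
    Together with [omega_nonempty] this makes the [inf] in [whittle] a true infimum and not a
    default value. *)
Lemma omega_lbound i : has_lbound [set nu : R | omega Q Rw nu i].
Proof.
pose b (p : {ffun 'I_d -> bool}) :=
  `|(sub_gain Q Rw 0 xpredT i - sub_gain Q Rw 0 p i) / passivity p i|.
exists (- \sum_p b p) => nu [pol [opt pi]].
have := opt xpredT i; rewrite sub_gain_all_active (sub_gain_affine nu pol).
have pp : 0 < passivity pol i by exact: passivity_gt0 pi.
rewrite -lerBlDl -ler_pdivrMr// => H; apply: le_trans H.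
rewrite lerNl; apply: (@le_trans _ _ (b (finfun pol))).
  by rewrite /b finfun_policy (le_trans (ler_norm _))// normrN.
by rewrite (bigD1 (finfun pol))//= lerDl; apply: sumr_ge0 => p _; exact: normr_ge0.
Qed.

(** A policy active in [i] has passivity below 1, so for a large subsidy the policy that is always
    passive beats it. *)
Lemma omega_nonempty i : [set nu : R | omega Q Rw nu i] !=set0.
Proof.
pose b (p : {ffun 'I_d -> bool}) :=
  `|(sub_gain Q Rw 0 p i - sub_gain Q Rw 0 pred0 i) / (1 - passivity p i)|.
pose nu := \sum_p b p + 1.
have [pol opt] := sub_optimal_exists nu i.
exists nu, pol; split=> //; case pi: (pol i) => //.
have := opt pred0 i; rewrite sub_gain_all_passive (sub_gain_affine nu pol) => H.
have pp : 0 < 1 - passivity pol i by rewrite subr_gt0; exact: passivity_lt1 pi.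
have : nu <= (sub_gain Q Rw 0 pol i - sub_gain Q Rw 0 pred0 i) / (1 - passivity pol i).
  by rewrite ler_pdivlMr//; lra.
move=> /le_trans/(_ (ler_norm _)) B.
have : b (finfun pol) <= \sum_p b p by rewrite (bigD1 (finfun pol))//= lerDl; apply: sumr_ge0 => p _; exact: normr_ge0.
by rewrite /b finfun_policy => /(le_trans B); rewrite /nu; lra.
Qed.

Lemma omega_lt_whittle nu i : nu < whittle Q Rw i -> ~ omega Q Rw nu i.
Proof. by move=> + H; apply/negP; rewrite -leNgt; apply: ge_inf => //; exact: omega_lbound. Qed.

Hypothesis idx : indexable Q Rw.

Lemma omega_gt_whittle nu i : whittle Q Rw i < nu -> omega Q Rw nu i.
Proof.
rewrite -subr_gt0 => H.
have [e ei] := inf_adherent H (conj (omega_nonempty i) (@omega_lbound i)).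
rewrite addrC subrK => /ltW en; exact: (idx en).
Qed.

Hypothesis whittle_decr : forall i j, (i < j)%N -> whittle Q Rw j < whittle Q Rw i.

(** For a subsidy just below the index of [s], all states up to [s] have a larger index, so every
    optimal policy is active there; [sub_optimal_closed] passes to the limit. *)
Lemma active_at_whittle (s : 'I_d) : exists pol,
  sub_optimal Q Rw (whittle Q Rw s) pol /\ forall i, (i <= s)%N -> pol i = true.
Proof.
apply: (@sub_optimal_closed _ _ s) => e e0.
pose nu := whittle Q Rw s - e / 2.
have [pol opt] := sub_optimal_exists nu s.
exists nu, pol; split=> //.
  by rewrite /nu opprB addrCA subrr addr0 gtr0_norm ?divr_gt0//; lra.
move=> i si; case pi: (pol i) => //.
have wi : whittle Q Rw s <= whittle Q Rw i.
  by move: si; rewrite leq_eqVlt => /orP[/eqP/val_inj->//|/whittle_decr/ltW].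
have: nu < whittle Q Rw i by rewrite /nu; lra.
by move=> /omega_lt_whittle[]; exists pol.
Qed.

(** The limit from above. The policy may depend on [j], because the Bellman equality is read state
    by state. *)
Lemma passive_at_whittle (s j : 'I_d) : (s <= j)%N -> exists pol,
  sub_optimal Q Rw (whittle Q Rw s) pol /\ pol j = false.
Proof.
move=> sj; have wj : whittle Q Rw j <= whittle Q Rw s.
  by move: sj; rewrite leq_eqVlt => /orP[/eqP/val_inj->//|/whittle_decr/ltW].
apply: (@sub_optimal_closed _ _ s) => e e0.
pose nu := whittle Q Rw s + e / 2.
have [pol [opt pj]] : omega Q Rw nu j by apply: omega_gt_whittle; rewrite /nu; lra.
exists nu, pol; split=> //.
by rewrite /nu opprD addrA subrr add0r normrN gtr0_norm ?divr_gt0//; lra.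
Qed.

(** At [s] both actions attain equality, so it costs nothing how the bandits in state [s] are
    divided between active and passive. *)
Lemma whittle_bellman (s : 'I_d) : exists g h,
  [/\ forall a i, sub_reward (whittle Q Rw s) a i + \sum_j Q a i j * h j <= g,
      forall i, (i <= s)%N ->
        sub_reward (whittle Q Rw s) true i + \sum_j Q true i j * h j = g &
      forall i, (s <= i)%N ->
        sub_reward (whittle Q Rw s) false i + \sum_j Q false i j * h j = g].
Proof.
have [g [h [le eq]]] := bellman (whittle Q Rw s) s.
exists g, h; split=> // i si.
  have [pol [opt pa]] := active_at_whittle s.
  by have := eq pol i opt; rewrite pa.
have [pol [opt pa]] := passive_at_whittle si.
by have := eq pol i opt; rewrite pa.
Qed.

End Subsidy.

(** * Existence of fluid trajectories *)

Section Picard.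
Local Open Scope classical_set_scope.
Variables (R : realType).

Lemma der_cstD (x c : R) f a : is_derive x 1 f a -> is_derive x 1 (fun t => c + f t) a.
Proof. by move=> /(derD (der_cst x c)); rewrite add0r. Qed.

Lemma der_norm_le (f g df dg : R -> R) (T : R) : 0 <= T ->
  (forall t, 0 <= t <= T -> is_derive t 1 f (df t)) ->
  (forall t, 0 <= t <= T -> is_derive t 1 g (dg t)) ->
  (forall t, 0 <= t <= T -> `|df t| <= dg t) -> `|f 0| <= g 0 -> `|f T| <= g T.
Proof.
move=> T0 Hf Hg Hd; rewrite !ler_norml => /andP[? ?].
have H1 := @der_le R (fun t => g t - f t) (fun t => dg t - df t) T T0.
have H2 := @der_le R (fun t => g t + f t) (fun t => dg t + df t) T T0.
have {}H1 : g 0 - f 0 <= g T - f T.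
  apply: H1 => t tT; first exact: derB (Hg _ tT) (Hf _ tT).
  by have := Hd _ tT; rewrite ler_norml => /andP[? ?]; lra.
have {}H2 : g 0 + f 0 <= g T + f T.
  apply: H2 => t tT; first exact: derD (Hg _ tT) (Hf _ tT).
  by have := Hd _ tT; rewrite ler_norml => /andP[? ?]; lra.
by apply/andP; split; lra.
Qed.

Lemma geometric_small (K e : R) : 0 < e -> exists n, K / 2 ^+ n <= e.
Proof.
move=> e0; pose n := (Num.truncn (`|K| / e)).+1; exists n.
rewrite ler_pdivrMr ?exprn_gt0//; apply: le_trans (ler_norm _) _.
rewrite mulrC -ler_pdivrMr//; apply: (@le_trans _ _ n%:R).
  by apply/ltW; rewrite truncnS_gt.
by rewrite -natrX ler_nat ltnW// ltn_expl.
Qed.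

(** With steps at most [K / 2 ^+ n], the intervals of radius [2 K / 2 ^+ n] around [u n] are nested;
    the supremum of their lower ends is the limit and comes with an explicit error. *)
Definition geometric_limit (u : nat -> R) (K : R) : R :=
  sup [set u n - 2 * K / 2 ^+ n | n in [set: nat]].

Lemma geometric_limitP (u : nat -> R) (K : R) :
  (forall n, `|u n.+1 - u n| <= K / 2 ^+ n) ->
  forall n, `|u n - geometric_limit u K| <= 2 * K / 2 ^+ n.
Proof.
move=> Hu; pose e n : R := 2 * K / 2 ^+ n.
have eS n : e n.+1 = e n - K / 2 ^+ n.
  have n0 : (2 ^+ n : R) != 0 by rewrite expf_neq0.
  by rewrite /e exprS; field; rewrite n0.
have e0 n : 0 <= e n.
  have := le_trans (normr_ge0 _) (Hu n).
  by rewrite /e -mulrA => ?; rewrite mulr_ge0.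
have vw k n : u n - e n <= u (k + n)%N - e (k + n)%N /\ u (k + n)%N + e (k + n)%N <= u n + e n.
  elim: k => // k [IH1 IH2]; rewrite addSn eS.
  by have := Hu (k + n)%N; rewrite ler_norml => /andP[? ?]; split; lra.
have cross n m : u n - e n <= u m + e m.
  have [nm|/ltnW nm] := leqP n m.
    have [+ _] := vw (m - n)%N n; rewrite subnK// => ?.
    by have := e0 m; lra.
  have [_ +] := vw (n - m)%N m; rewrite subnK// => ?.
  by have := e0 n; lra.
move=> n; rewrite /geometric_limit -/(e n) ler_norml; apply/andP; split.
  rewrite lerNl opprB lerBlDr addrC; apply: ge_sup; first by exists (u 0%N - e 0%N), 0%N.
  by move=> _ [m _ <-]; exact: cross.
rewrite lerBlDl -lerBlDr; apply: ub_le_sup; last by exists n.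
by exists (u 0%N + e 0%N) => _ [m _ <-]; exact: cross.
Qed.

(* The lower end [-1] makes [0] an interior point of the domain. *)
Definition primitive (f : R -> R) (t : R) : R :=
  \int[lebesgue_measure]_(s in `[-1, t]) f s - \int[lebesgue_measure]_(s in `[-1, 0]) f s.

Lemma primitive0 f : primitive f 0 = 0.
Proof. exact: subrr. Qed.

Lemma der_primitive f (t : R) : continuous f -> 0 <= t -> is_derive t 1 (primitive f) (f t).
Proof.
move=> cf t0.
have int : lebesgue_measure.-integrable `[-1, t + 1] (EFin \o f).
  by apply: continuous_compact_integrable; [exact: segment_compact | exact: continuous_subspaceT].
have t1 : t < t + 1 by rewrite ltrDl.
have t2 : -1 < t by rewrite (lt_le_trans _ t0)// oppr_lt0.
have [df fE] := continuous_FTC1_closed t1 int t2 (cf t).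
have D : is_derive t 1 (fun u => \int[lebesgue_measure]_(s in `[-1, u]) f s) (f t).
  by apply: DeriveDef => //; rewrite -derive1E.
by have := derB D (der_cst t (\int[lebesgue_measure]_(s in `[-1, 0]) f s)); rewrite subr0.
Qed.

Variables (X : finType) (F : (X -> R) -> X -> R) (L : R).
Hypothesis L0 : 0 <= L.
Hypothesis lipF : forall x y i, `|F x i - F y i| <= L * \sum_k `|x k - y k|.

Lemma lipschitz_continuous (y : X -> R -> R) i :
  (forall k, continuous (y k)) -> continuous (fun s => F (fun k => y k s) i).
Proof.
move=> cy s0; apply/cvgrPdist_le => e e0.
have H : (fun s => L * \sum_k `|y k s0 - y k s|) @ s0 --> L * \sum_k `|y k s0 - y k s0|.
  apply: cvgMr; apply: cvg_big => [|k _]; first exact: add_continuous.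
  apply: cvg_norm; apply: cvgB; [exact: cvg_cst | exact: cy].
rewrite [X in _ --> X](_ : _ = 0) in H; last first.
  by rewrite big1 ?mulr0// => k _; rewrite subrr normr0.
move/cvgrPdist_le : H => /(_ e e0); apply: filterS => s.
rewrite sub0r normrN => /(le_trans (ler_norm _)); apply: le_trans.
exact: lipF.
Qed.

Variable m : X -> R.

(* The field is frozen at negative times, so that only times [t >= 0] matter. *)
Fixpoint picard n (i : X) (t : R) : R :=
  match n with
  | 0 => m i
  | n'.+1 => m i + primitive (fun s => F (fun k => picard n' k (Num.max s 0)) i) t
  end.

Lemma continuous_frozen (y : R -> R) :
  (forall t : R, 0 <= t -> {for t, continuous y}) ->
  continuous (fun s : R => y (Num.max s 0)).
Proof.
move=> cy s; apply: (@continuous_comp R R R (fun s : R => Num.max s 0) y s).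
  by apply: continuous_max; [exact: cvg_id|exact: cvg_cst].
by apply: cy; rewrite le_max lexx orbT.
Qed.

Lemma picard0 n i : picard n i 0 = m i.
Proof. by case: n => //= n; rewrite primitive0 addr0. Qed.

Lemma picard_continuous n i (t : R) : 0 <= t -> {for t, continuous (picard n i)}.
Proof.
elim: n i t => [|n IH] i t t0; first exact: cvg_cst.
have D := @der_primitive (fun s => F (fun k => picard n k (Num.max s 0)) i) t.
apply: der_continuous; apply: (der_cstD (m i) (D _ t0)).
by apply: lipschitz_continuous => k; apply: continuous_frozen => s; exact: IH.
Qed.

Lemma der_picard n i (t : R) : 0 <= t ->
  is_derive t 1 (picard n.+1 i) (F (fun k => picard n k t) i).
Proof.
move=> t0.
have := @der_primitive (fun s => F (fun k => picard n k (Num.max s 0)) i) t.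
rewrite (max_idPl t0) => D; apply: (der_cstD (m i) (D _ t0)).
by apply: lipschitz_continuous => k; apply: continuous_frozen => s; exact: picard_continuous.
Qed.

(** Chosen so that Picard errors halve at each step when measured against [expR (kap * t)]: the
    Lipschitz bound [L #|X| E n] equals [2 L #|X| E n.+1], hence is at most the derivative
    [kap * E n.+1]. The [+ 1] gives [kap >= 1], used for the first step. *)
Let kap := 2 * L * #|X|%:R + 1.
Let C : R := \sum_i `|F m i|.
Let E n (t : R) : R := C * expR (kap * t) / 2 ^+ n.

Let C0 : 0 <= C. Proof. exact: sumr_ge0. Qed.
Let kap1 : 1 <= kap.
Proof. by rewrite /kap lerDr !mulr_ge0. Qed.
Let E0 n (t : R) : 0 <= E n t.
Proof. by rewrite /E !mulr_ge0 ?expR_ge0// invr_ge0 exprn_ge0. Qed.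

Let der_E n (t : R) : is_derive t 1 (E n) (kap * E n t).
Proof.
have := derZ (C / 2 ^+ n) (der_expR (derZ kap (der_id t))).
rewrite (_ : (fun t => _) = E n); last by apply/funext => s; rewrite /E mulrAC.
by move=> H; apply: is_derive_eq H _; rewrite /E mulr1; ring.
Qed.

Let lip_E n t (x y : X -> R) i : (forall k, `|x k - y k| <= E n t) ->
  `|F x i - F y i| <= kap * E n.+1 t.
Proof.
move=> H; apply: le_trans (lipF _ _ _) _.
apply: (@le_trans _ _ (L * (#|X|%:R * E n t))).
  rewrite ler_wpM2l// mulr_natl -sumr_const; exact: ler_sum.
have -> : E n.+1 t = E n t / 2.
  have n0 : (2 ^+ n : R) != 0 by rewrite expf_neq0.
  by rewrite /E exprS; field; rewrite n0.
have -> : L * (#|X|%:R * E n t) = (2 * L * #|X|%:R) * (E n t / 2) by field.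
apply: ler_wpM2r; first by rewrite divr_ge0// E0.
by rewrite /kap lerDl.
Qed.

Lemma picard_step n i (t : R) : 0 <= t -> `|picard n.+1 i t - picard n i t| <= E n t.
Proof.
elim: n i t => [|n IH] i t t0.
  apply: (@der_norm_le (fun t => picard 1 i t - picard 0 i t) (E 0)
    (fun t => F m i - 0) (fun t => kap * E 0 t) t t0).
  - move=> s /andP[s0 _]; apply: derB; [exact: der_picard | exact: der_cst].
  - by move=> s _; exact: der_E.
  - move=> s /andP[s0 _]; rewrite subr0 /E expr0 divr1 mulrCA.
    apply: (@le_trans _ _ C); first by rewrite /C (bigD1 i)//= lerDl sumr_ge0.
    have e1 : 1 <= expR (kap * s).
      by rewrite (le_trans _ (expR_ge1Dx _))// lerDl mulr_ge0// (le_trans _ kap1).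
    rewrite -[leLHS]mulr1; apply: ler_wpM2l => //; exact: mulr_ege1.
  - by rewrite picard0 subrr normr0.
apply: (@der_norm_le (fun t => picard n.+2 i t - picard n.+1 i t) (E n.+1)
    (fun t => F (fun k => picard n.+1 k t) i - F (fun k => picard n k t) i)
    (fun t => kap * E n.+1 t) t t0).
- by move=> s /andP[s0 _]; apply: derB; exact: der_picard.
- by move=> s _; exact: der_E.
- by move=> s /andP[s0 _]; apply: lip_E => k; exact: IH.
- by rewrite !picard0 subrr normr0.
Qed.

Let lim i t := geometric_limit (fun n => picard n i t) (C * expR (kap * t)).

Let lim_le n i (t : R) : 0 <= t -> `|picard n i t - lim i t| <= 2 * E n t.
Proof.
move=> t0; rewrite /E !mulrA; rewrite -[2 * C * _]mulrA.
apply: (geometric_limitP (u := fun n => picard n i t)) => k.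
exact: picard_step.
Qed.

Let lim_continuous i : continuous (fun s : R => lim i (Num.max s 0)).
Proof.
move=> s0; apply/cvgrPdist_le => e e0.
(* The error bound grows with time, so its value at [t1] fixes one [n] for all [s] near [s0]. *)
pose t1 := Num.max s0 0 + 1.
have [n Hn] := geometric_small (2 * (C * expR (kap * t1))) (e := e / 3) ltac:(lra).
have En s : s < s0 + 1 -> 2 * E n (Num.max s 0) <= e / 3.
  move=> s01; apply: le_trans Hn; rewrite /E !mulrA ler_wpM2r ?invr_ge0 ?exprn_ge0//.
  rewrite ler_wpM2l ?mulr_ge0// ler_expR ler_wpM2l ?(le_trans _ kap1)// /t1.
  rewrite ge_max; apply/andP; split; last by rewrite addr_ge0// le_max lexx orbT.
  by rewrite (le_trans (ltW s01))// lerD2r le_max lexx.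
have cn : continuous (fun s : R => picard n i (Num.max s 0)).
  by apply: continuous_frozen => t; exact: picard_continuous.
have /cvgrPdist_le/(_ (e / 3) ltac:(lra)) := cn s0.
have : \forall s \near s0, s < s0 + 1 by apply: lt_nbhsl; rewrite ltrDl.
apply: filterS2 => s ss H.
have A1 := @lim_le n i (Num.max s 0) ltac:(by rewrite le_max lexx orbT).
have A2 := @lim_le n i (Num.max s0 0) ltac:(by rewrite le_max lexx orbT).
have B1 := En s ss; have B2 := En s0 ltac:(by rewrite ltrDl).
move: A1 A2 H; rewrite !ler_norml => /andP[? ?] /andP[? ?] /andP[? ?].
by apply/andP; split; lra.
Qed.

Lemma picard_lindelof : exists x : R -> X -> R, x 0 = m /\
  forall (t : R) i, 0 <= t -> is_derive t 1 (fun u => x u i) (F (x t) i).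
Proof.
pose f i (s : R) := F (fun k => lim k (Num.max s 0)) i.
have cf i : continuous (f i) by apply: lipschitz_continuous => k; exact: lim_continuous.
(* One more Picard step from the limit, so the derivative is known; [x] is then identified with the
   limit, both being close to the iterates. *)
pose x (t : R) i := m i + primitive (f i) t.
have dx i (t : R) : 0 <= t -> is_derive t 1 (fun u => x u i) (F (lim ^~ t) i).
  move=> t0; apply: (der_cstD (m i)).
  by have := @der_primitive (f i) t (cf i) t0; rewrite {2}/f (max_idPl t0).
have x0 : x 0 = m by apply/funext => i; rewrite /x primitive0 addr0.
have near n i (t : R) : 0 <= t -> `|x t i - picard n.+1 i t| <= 2 * E n t.
  move=> t0; apply: (@der_norm_le (fun t => x t i - picard n.+1 i t) (fun t => 2 * E n t)
    (fun t => F (lim ^~ t) i - F (fun k => picard n k t) i) (fun t => 2 * (kap * E n t)) t t0).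
  - by move=> s /andP[s0 _]; apply: derB; [exact: dx | exact: der_picard].
  - by move=> s _; apply: derZ; exact: der_E.
  - move=> s /andP[s0 _]; have H k : `|lim k s - picard n k s| <= E n s + E n s.
      by rewrite distrC; have := lim_le n k s0; lra.
    apply: le_trans (lipF _ _ _) _.
    apply: (@le_trans _ _ (L * (#|X|%:R * (E n s + E n s)))).
      by rewrite ler_wpM2l// mulr_natl -sumr_const; exact: ler_sum.
    rewrite (_ : L * _ = 2 * L * #|X|%:R * E n s); last by ring.
    rewrite mulrA ler_wpM2r// /kap mulrDr mulr1.
    have : 0 <= L * #|X|%:R by rewrite mulr_ge0.
    by lra.
  - by rewrite x0 picard0 subrr normr0 mulr_ge0.
have xlim (t : R) : 0 <= t -> x t = lim ^~ t.
  move=> t0; apply/funext => i; apply/eqP; rewrite -subr_eq0 -normr_le0.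
  apply/ler_addgt0Pl => e e0; rewrite addr0.
  have [n Hn] := geometric_small (3 * (C * expR (kap * t))) e0.
  have := near n i t t0; have := lim_le n.+1 i t0.
  have -> : E n.+1 t = E n t / 2.
    have n0 : (2 ^+ n : R) != 0 by rewrite expf_neq0.
    by rewrite /E exprS; field; rewrite n0.
  have : 3 * E n t <= e by rewrite /E mulrA.
  rewrite !ler_norml => ? /andP[? ?] /andP[? ?]; apply/andP; split; lra.
exists x; split=> // t i t0; rewrite xlim//; exact: dx.
Qed.

End Picard.

(** * The fluid drift *)

Section Drift.
Variables (R : realType) (d : nat) (Q : bool -> 'I_d -> 'I_d -> R) (alpha : R).
Hypothesis genQ : forall a, is_generator (Q a).
Implicit Types (m x y : 'I_d -> R) (i j s : 'I_d).

Definition cum m (k : nat) : R := \sum_(j : 'I_d | (j < k)%N) m j.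

(** The part of the mass of state [i] that lies in the first [alpha] units, counted from state 0.
    The [min] form avoids the case distinction on [s(m)], makes sense for every [m], and is
    Lipschitz. *)
Definition active_mass m i : R := Num.min alpha (cum m i.+1) - Num.min alpha (cum m i).

Definition drift m j : R :=
  \sum_i (active_mass m i * Q true i j + (m i - active_mass m i) * Q false i j).

Lemma cumS m i : cum m i.+1 = cum m i + m i.
Proof.
rewrite /cum (bigD1 i) ?ltnS//= addrC; congr (_ + _).
by apply: eq_bigl => j; rewrite ltnS [RHS]ltn_neqAle andbC.
Qed.

Lemma cum_le m k l : (forall i, 0 <= m i) -> (k <= l)%N -> cum m k <= cum m l.
Proof.
move=> m0 kl; rewrite /cum [leRHS](bigID (fun j : 'I_d => (j < k)%N))/=.
rewrite [X in X + _](eq_bigl (fun j : 'I_d => (j < k)%N)); last first.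
  by move=> j /=; case jk: (j < k)%N; rewrite ?andbF// ?andbT ?(leq_trans jk kl).
by rewrite lerDl sumr_ge0.
Qed.

Lemma cum0 m : cum m 0 = 0.
Proof. by rewrite /cum big_pred0. Qed.

Lemma cum_total m : cum m d = \sum_i m i.
Proof. by rewrite /cum; apply: eq_bigl => j; rewrite ltn_ord. Qed.

Lemma active_mass_bounds m i : (forall k, 0 <= m k) -> 0 <= active_mass m i <= m i.
Proof.
move=> m0; have := m0 i; rewrite /active_mass cumS.
by case: (leP alpha (cum m i + m i)); case: (leP alpha (cum m i)); lra.
Qed.

(** The index is the predecessor of the least [k] with [alpha < cum m k]; [0 < alpha] excludes
    [k = 0], and [alpha < 1] provides such a [k]. *)
Lemma sidx_exists m : in_simplex m -> 0 < alpha < 1 ->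
  exists s, [/\ sidx alpha m = Some s, cum m s <= alpha & alpha < cum m s.+1].
Proof.
move=> [m0 m1] /andP[a0 a1]; rewrite /sidx.
case: pickP => [s /andP[H1 H2]|none]; first by exists s; split.
have ex : exists k, alpha < cum m k by exists d; rewrite cum_total m1.
case: (ex_minnP ex) => k ak kmin.
have kd : (k <= d)%N by apply: kmin; rewrite cum_total m1.
case: k ak kmin kd => [|k] ak kmin kd; first by rewrite cum0 in ak; lra.
have := none (Ordinal kd); rewrite -[X in X && _]/(cum m k <= alpha) -[X in _ && X]/(alpha < cum m k.+1).
rewrite ak andbT leNgt; case: ltP => // ck.
by have := kmin k ck; rewrite ltnn.
Qed.

Lemma active_massE m s i : (forall k, 0 <= m k) ->
  cum m s <= alpha -> alpha < cum m s.+1 ->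
  active_mass m i = if (i < s)%N then m i else if i == s then alpha - cum m s else 0.
Proof.
move=> m0 H1 H2; rewrite /active_mass; case: ltngtP => [lt|gt|/val_inj ->].
- rewrite (min_idPr (le_trans (cum_le m0 lt) H1)).
  rewrite (min_idPr (le_trans (cum_le m0 (ltnW lt)) H1)).
  by rewrite cumS; ring.
- have E : (i == s) = false by apply/negbTE; rewrite neq_ltn gt orbT.
  rewrite E (min_idPl (le_trans (ltW H2) (cum_le m0 gt))).
  by rewrite (min_idPl (le_trans (ltW H2) (cum_le m0 (leqW gt)))) subrr.
- by rewrite eqxx (min_idPl (ltW H2)) (min_idPr H1).
Qed.

Lemma tau_ge a i : `|Q a i i| <= tau Q.
Proof.
apply: (@le_trans _ _ (Num.max `|Q false i i| `|Q true i i|)).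
  by rewrite le_max; case: a; rewrite lexx ?orbT.
by rewrite /tau; apply: (le_bigmax _ (fun i => Num.max `|Q false i i| `|Q true i i|)).
Qed.

Lemma row_sum a i : \sum_(j | j != i) Q a i j = - Q a i i.
Proof.
have [_ /(_ i)] := genQ a; rewrite (bigD1 i)//= => /eqP.
by rewrite addrC addr_eq0 => /eqP.
Qed.

Lemma rate_ge0 a i j : i != j -> 0 <= Q a i j.
Proof. by have [H _] := genQ a; exact: H. Qed.

Lemma tau_ge0 i : 0 <= tau Q.
Proof. exact: le_trans (tau_ge true i). Qed.

Lemma row_sum_le a i : \sum_(j | j != i) Q a i j <= tau Q.
Proof. by rewrite row_sum (le_trans _ (tau_ge a i))// -normrN ler_norm. Qed.

Lemma tau_Pu a i j : tau Q * Pu Q a i j = Q a i j + tau Q * (i == j)%:R.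
Proof.
have scale k : k != i -> tau Q * (Q a i k / tau Q) = Q a i k.
  (* If [tau Q] is 0 the quotient is 0 by convention, and so is the rate, being nonnegative with
     off-diagonal row sums at most [tau Q]. *)
  move=> ki; have [t0|t0] := eqVneq (tau Q) 0; last by rewrite mulrCA divff ?mulr1.
  rewrite t0 mul0r; apply/esym/le_anti; rewrite rate_ge0 1?eq_sym// andbT -t0.
  apply: le_trans (row_sum_le a i); rewrite (bigD1 k)//= lerDl.
  by apply: sumr_ge0 => l /andP[li _]; rewrite rate_ge0// eq_sym.
rewrite /Pu; have [<-|ij] := eqVneq i j; last by rewrite mulr0 addr0 scale// eq_sym.
rewrite mulrBr mulr_sumr (eq_bigr (Q a i)); last by move=> k; exact: scale.
by rewrite row_sum mulr1 opprK addrC.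
Qed.

Lemma drift_phi m j : in_simplex m -> 0 < alpha < 1 ->
  drift m j = tau Q * (phi Q alpha m j - m j).
Proof.
move=> ms a01; have [s [sE H1 H2]] := sidx_exists ms a01; have [m0 m1] := ms.
have split_sum (f : 'I_d -> R) :
    \sum_i f i = \sum_(i : 'I_d | (i < s)%N) f i + f s + \sum_(i : 'I_d | (s < i)%N) f i.
  rewrite (bigID (fun i : 'I_d => (i < s)%N))/= -addrA; congr (_ + _).
  rewrite (bigD1 s) ?ltnn//=; congr (_ + _); apply: eq_bigl => i.
  by rewrite -leqNgt [RHS]ltn_neqAle andbC eq_sym.
have phiE : phi Q alpha m j = \sum_i (active_mass m i * Pu Q true i j +
    (m i - active_mass m i) * Pu Q false i j).
  transitivity (\sum_(i : 'I_d | (i < s)%N) m i * Pu Q true i j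
      + (alpha - cum m s) * Pu Q true s j + (cum m s.+1 - alpha) * Pu Q false s j
      + \sum_(i : 'I_d | (s < i)%N) m i * Pu Q false i j); first by rewrite /phi sE.
  rewrite split_sum; congr (_ + _); first rewrite -addrA; first congr (_ + _).
  - by apply: eq_bigr => i lt; rewrite (active_massE _ m0 H1 H2) lt subrr mul0r addr0.
  - by rewrite (active_massE _ m0 H1 H2) ltnn eqxx cumS; ring.
  apply: eq_bigr => i gt; rewrite (active_massE _ m0 H1 H2) ltnNge (ltnW gt)/=.
  have -> : (i == s) = false by apply/negbTE; rewrite neq_ltn gt orbT.
  by rewrite mul0r add0r subr0.
rewrite mulrBr phiE mulr_sumr /drift.
have -> : tau Q * m j = \sum_i tau Q * m i * (i == j)%:R.
  rewrite (bigD1 j)//= eqxx mulr1 big1 ?addr0// => i ij.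
  by rewrite (negbTE ij) mulr0.
rewrite -sumrB; apply: eq_bigr => i _.
rewrite mulrDr [tau Q * (active_mass _ _ * _)]mulrCA [tau Q * (_ * _)]mulrCA !tau_Pu.
ring.
Qed.

(** With [D] the l1 distance, the coefficients of [Q true] vary by at most [2 D] and those of
    [Q false] by at most [3 D]; 5 covers both. *)
Definition lip_const : R := 5 * \sum_i \sum_j (`|Q true i j| + `|Q false i j|).

Lemma lip_const_ge0 : 0 <= lip_const.
Proof. by rewrite mulr_ge0// sumr_ge0// => i _; rewrite sumr_ge0// => j _; rewrite addr_ge0. Qed.

Lemma min_lipschitz (u v : R) : `|Num.min alpha u - Num.min alpha v| <= `|u - v|.
Proof.
have := ler_norm (u - v); have := ler_norm (v - u); rewrite [`|v - u|]distrC.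
by case: (leP alpha u); case: (leP alpha v) => *; rewrite ler_norml; apply/andP; split; lra.
Qed.

Lemma cum_lipschitz x y k : `|cum x k - cum y k| <= \sum_i `|x i - y i|.
Proof.
rewrite /cum -sumrB; apply: le_trans (ler_norm_sum _ _ _) _.
rewrite [leRHS](bigID (fun j : 'I_d => (j < k)%N))/= lerDl.
exact: sumr_ge0.
Qed.

Lemma active_mass_lipschitz x y i :
  `|active_mass x i - active_mass y i| <= 2 * \sum_i `|x i - y i|.
Proof.
have A := le_trans (min_lipschitz (cum x i.+1) (cum y i.+1)) (cum_lipschitz x y i.+1).
have B := le_trans (min_lipschitz (cum x i) (cum y i)) (cum_lipschitz x y i).
rewrite /active_mass; move: A B; rewrite !ler_norml => /andP[? ?] /andP[? ?].
by apply/andP; split; lra.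
Qed.

Lemma drift_lipschitz x y j : `|drift x j - drift y j| <= lip_const * \sum_i `|x i - y i|.
Proof.
pose D := \sum_i `|x i - y i|; have D0 : 0 <= D by exact: sumr_ge0.
apply: (@le_trans _ _ (\sum_i 5 * D * (`|Q true i j| + `|Q false i j|))).
  rewrite /drift -sumrB; apply: le_trans (ler_norm_sum _ _ _) _.
  apply: ler_sum => i _.
  have Da := active_mass_lipschitz x y i; rewrite -/D in Da.
  have Dx : `|x i - y i| <= D by rewrite /D (bigD1 i)//= lerDl sumr_ge0.
  set a := active_mass x i; set b := active_mass y i.
  rewrite -/a -/b in Da.
  have -> : a * Q true i j + (x i - a) * Q false i j - (b * Q true i j + (y i - b) * Q false i j)
    = (a - b) * Q true i j + ((x i - y i) - (a - b)) * Q false i j by ring.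
  apply: le_trans (ler_normD _ _) _; rewrite !normrM mulrDr; apply: lerD.
    by rewrite ler_wpM2r//; lra.
  by rewrite ler_wpM2r//; apply: le_trans (ler_normB _ _) _; lra.
rewrite -mulr_sumr mulrAC /lip_const -/D.
rewrite ler_wpM2r// ler_wpM2l//; apply: ler_sum => i _.
by rewrite [leRHS](bigD1 j)//= lerDl sumr_ge0// => k _; rewrite addr_ge0.
Qed.

Lemma drift_sum m : \sum_j drift m j = 0.
Proof.
rewrite /drift exchange_big/= big1// => i _; rewrite big_split/= -!mulr_sumr.
by have [_ ->] := genQ true; have [_ ->] := genQ false; rewrite !mulr0 addr0.
Qed.

(** Mass leaves a state at rate at most [tau Q] per unit; this keeps fluid solutions nonnegative. *)
Lemma drift_lower m j : (forall i, 0 <= m i) -> 0 <= drift m j + tau Q * m j.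
Proof.
move=> m0; rewrite /drift (bigD1 j)//= -addrA addrCA addr_ge0//.
  apply: sumr_ge0 => i ij; have /andP[a0 a1] := active_mass_bounds i m0.
  by rewrite addr_ge0// mulr_ge0// ?rate_ge0// subr_ge0.
have /andP[a0 a1] := active_mass_bounds j m0.
have qt : 0 <= Q true j j + tau Q.
  by have := tau_ge true j; rewrite ler_norml => /andP[? _]; lra.
have qf : 0 <= Q false j j + tau Q.
  by have := tau_ge false j; rewrite ler_norml => /andP[? _]; lra.
have -> : active_mass m j * Q true j j + (m j - active_mass m j) * Q false j j + tau Q * m j
  = active_mass m j * (Q true j j + tau Q) + (m j - active_mass m j) * (Q false j j + tau Q) by ring.
by rewrite addr_ge0// mulr_ge0// subr_ge0.
Qed.

Lemma fluid_solution m : in_simplex m -> exists x : R -> 'I_d -> R,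
  [/\ x 0 = m, forall t, 0 <= t -> in_simplex (x t) &
      forall (t : R) i, 0 <= t -> is_derive t 1 (fun u => x u i) (drift (x t) i)].
Proof.
move=> [m0 m1].
have [i0|noi] := pickP (fun _ : 'I_d => true); last first.
  by move: m1; rewrite big_pred0 => [/eqP|i]; [rewrite eq_sym oner_eq0|have := noi i].
move=> _; have t0 := tau_ge0 i0.
(* Taking positive parts makes the field point inwards on the boundary of
   the orthant, so that the solution stays nonnegative. *)
pose pos x i := Num.max (x i) 0 : R.
pose F x i := drift (pos x) i + tau Q * pos x i - tau Q * x i.
have pos0 x i : 0 <= pos x i by rewrite /pos le_max lexx orbT.
have lip_pos x y i : `|pos x i - pos y i| <= `|x i - y i|.
  rewrite /pos; case: (leP (x i) 0) => xi; case: (leP (y i) 0) => yi.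
  - by rewrite subrr normr0.
  - by rewrite ler_norml; have := ler_norm (y i - x i); rewrite distrC; lra.
  - by rewrite ler_norml; have := ler_norm (x i - y i); lra.
  - by [].
have sum_ge x y i : `|x i - y i| <= \sum_k `|x k - y k|.
  by rewrite (bigD1 i)//= lerDl sumr_ge0.
have lipF x y i : `|F x i - F y i| <= (lip_const + 2 * tau Q) * \sum_k `|x k - y k|.
  rewrite mulrDl -mulrA mulr_natl mulr2n.
  have -> : F x i - F y i = (drift (pos x) i - drift (pos y) i) +
     (tau Q * (pos x i - pos y i) - tau Q * (x i - y i)) by rewrite /F; ring.
  apply: le_trans (ler_normD _ _) _; apply: lerD.
    apply: le_trans (drift_lipschitz _ _ _) _; rewrite ler_wpM2l ?lip_const_ge0//.
    by apply: ler_sum => k _.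
  apply: le_trans (ler_normB _ _) _; rewrite !normrM (ger0_norm t0).
  by apply: lerD; rewrite ler_wpM2l// (le_trans (lip_pos _ _ _)).
have L0 : 0 <= lip_const + 2 * tau Q by rewrite addr_ge0 ?lip_const_ge0 ?mulr_ge0.
have [x [x0 dx]] := picard_lindelof L0 lipF m.
have xge0 (t : R) i : 0 <= t -> 0 <= x t i.
  (* The integrating factor cancels the term [- tau Q * x i] of the field, and the rest is
     nonnegative by [drift_lower]. *)
  move=> tge; pose g (s : R) := expR (tau Q * s) * x s i.
  have := @der_le R g (fun s : R => expR (tau Q * s) * (drift (pos (x s)) i + tau Q * pos (x s) i)) t tge.
  rewrite /g mulr0 expR0 mul1r x0 => H.
  rewrite -(pmulr_rge0 _ (expR_gt0 (tau Q * t))); apply: le_trans (m0 i) _; apply: H.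
    move=> r /andP[r0 _].
    have := derM (der_expR (derZ (tau Q) (der_id r))) (dx r i r0).
    by move=> H; apply: is_derive_eq H _; rewrite /F mulr1; ring.
  by move=> s _; rewrite mulr_ge0 ?expR_ge0 ?drift_lower.
have posx (t : R) : 0 <= t -> pos (x t) = x t.
  by move=> t0'; apply/funext => i; rewrite /pos; apply/max_idPl; exact: xge0.
have dx' (t : R) i : 0 <= t -> is_derive t 1 (fun u => x u i) (drift (x t) i).
  by move=> tge; have := dx t i tge; rewrite /F posx// addrK.
exists x; split=> // t tge; split=> [i|]; first exact: xge0.
rewrite -m1 -x0; suff H : \sum_i x 0 i = \sum_i x t i by rewrite H.
apply: (@der_eq R (fun s : R => \sum_i x s i) t tge) => r /andP[r0 _].
exact: is_derive_eq (der_sum xpredT (fun i => dx' r i r0)) (drift_sum (x r)).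
Qed.

End Drift.

(** * The Markov chain of the bandits *)

Section Bandits.
Variables (R : realType) (N d : nat) (Q : bool -> 'I_d -> 'I_d -> R).
Hypothesis genQ : forall a, is_generator (Q a).
Implicit Types (s : bstate N d) (x y : bstate N d * bact N) (n : 'I_N) (i j : 'I_d).

Definition move s n j : bstate N d := [ffun k => if k == n then j else s k].

Section Policy.
Variable pol : bstate N d -> bact N -> R.
Hypothesis polP : is_rpolicy pol.

Lemma brate_ge0 x y : 0 <= brate Q pol x y.
Proof.
rewrite /brate mulr_ge0//; last by have [H _] := polP y.1; exact: H.
apply: sumr_ge0 => n _; rewrite /onlydiff; have [E|ne] := eqVneq (x.1 n) (y.1 n).
  by rewrite mul0r.
by rewrite mulr_ge0// (rate_ge0 genQ).
Qed.

Lemma generator_bgen : generator (bgen Q pol).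
Proof.
split=> [x y xy|x]; first by rewrite /bgen (negbTE xy) brate_ge0.
rewrite (bigD1 x)//= {1}/bgen eqxx addrC; apply/eqP; rewrite subr_eq0; apply/eqP.
by apply: eq_bigr => y yx; rewrite /bgen eq_sym (negbTE yx).
Qed.

Lemma app_bgen f x : app (bgen Q pol) f x = \sum_y brate Q pol x y * (f y - f x).
Proof.
rewrite (app_generator generator_bgen) [RHS](bigD1 x)//= subrr mulr0 add0r.
by apply: eq_bigr => y yx; rewrite /bgen eq_sym (negbTE yx).
Qed.

Lemma onlydiff_move s s' n : onlydiff s s' n -> s' = move s n (s' n).
Proof.
move=> /andP[_ /forallP H]; apply/ffunP => k; rewrite ffunE.
by have [->//|kn] := eqVneq k n; have := H k; rewrite kn => /eqP.
Qed.

Lemma onlydiffE s n j : onlydiff s (move s n j) n = (j != s n).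
Proof.
rewrite /onlydiff ffunE eqxx eq_sym; case: eqP => //= _.
by apply/forallP => k; rewrite ffunE; apply/implyP => /negbTE ->.
Qed.

(** For a function of the bandit states alone, the law of the redrawn action sums to 1, and the
    successor states are indexed by the moving bandit and its new state. *)
Lemma app_bgen_state (k : bstate N d -> R) x :
  app (bgen Q pol) (fun y => k y.1) x =
  \sum_n \sum_(j | j != x.1 n) Q (x.2 n) (x.1 n) j * (k (move x.1 n j) - k x.1).
Proof.
rewrite app_bgen.
transitivity (\sum_s' \sum_a' brate Q pol x (s', a') * (k s' - k x.1)).
  by rewrite pair_bigA; apply: eq_bigr => -[].
transitivity (\sum_s' \sum_n (onlydiff x.1 s' n)%:R * (Q (x.2 n) (x.1 n) (s' n) * (k s' - k x.1))).
  apply: eq_bigr => s' _; rewrite /brate/=.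
  under eq_bigr do rewrite mulrAC.
  rewrite -mulr_sumr; have [_ ->] := polP s'; rewrite mulr1 mulr_suml.
  by apply: eq_bigr => n _; rewrite mulrA.
rewrite exchange_big/=; apply: eq_bigr => n _.
rewrite (bigID (fun s' => onlydiff x.1 s' n))/= [X in _ + X]big1 ?addr0; last first.
  by move=> s' /negbTE ->; rewrite mul0r.
rewrite (reindex_onto (move x.1 n) (fun s' : bstate N d => s' n))/=; last first.
  by move=> s' /onlydiff_move.
apply: eq_big => [j|j].
  by rewrite onlydiffE ffunE eqxx eqxx andbT.
by rewrite onlydiffE => /andP[-> _]; rewrite mul1r ffunE eqxx.
Qed.

Lemma binit_ge0 s0 x : 0 <= binit pol s0 x.
Proof. by rewrite /binit mulr_ge0//; have [H _] := polP s0; exact: H. Qed.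

Lemma binit_sum s0 : \sum_x binit pol s0 x = 1.
Proof.
transitivity (\sum_s \sum_a (s == s0)%:R * pol s0 a).
  by rewrite pair_bigA; apply: eq_bigr => -[].
rewrite (bigD1 s0)//= [X in _ + X]big1 ?addr0.
  by rewrite -mulr_sumr eqxx mul1r; have [_ ->] := polP s0.
by move=> s /negbTE ->; apply: big1 => a _; rewrite mul0r.
Qed.

End Policy.

(** * The Whittle policy: its closed set, its ranking of bandits, the empirical measure *)

Section Wip.
Variable K : nat.
Let pol := @wip_pol R N d K.

Lemma wip_pol_policy : is_rpolicy pol.
Proof.
move=> s; split=> [a|]; first exact: ler0n.
rewrite (bigD1 (wip_act K s))//= /pol /wip_pol eqxx big1 ?addr0// => a.
by move=> /negbTE ->.
Qed.

Definition wip_states : pred (bstate N d * bact N) := fun x => x.2 == wip_act K x.1.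

Lemma wip_closed : closed_under (bgen Q pol) wip_states.
Proof.
move=> x y Dx Dy; rewrite /bgen ifF; last first.
  by apply/negbTE/eqP => xy; move: Dy; rewrite -xy Dx.
by rewrite /brate /pol /wip_pol (negbTE (Dy : y.2 != _)) mulr0.
Qed.

Lemma binit_wip s0 x : ~~ wip_states x -> binit pol s0 x = 0.
Proof.
rewrite /binit /wip_states; have [->|_] := eqVneq x.1 s0; last by rewrite mul0r.
by rewrite /pol /wip_pol => /negbTE ->; rewrite mulr0.
Qed.

End Wip.

(* Finite sets, whereas [wip_act] counts a classical set. *)
Definition below s (k : nat) : {set 'I_N} := [set n | (s n < k)%N].
Definition rank s n : nat := #|[set m : 'I_N | ((s m < s n)%N || ((s m == s n) && (m < n)%N))]|.

Lemma rank_lt_below s n (k : nat) : (s n < k)%N -> (rank s n < #|below s k|)%N.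
Proof.
move=> nk; rewrite /rank /below; apply: proper_card; apply/properP; split; last first.
  by exists n; rewrite inE ?nk// eqxx !ltnn.
apply/fintype.subsetP => m; rewrite !inE => /orP[lt|/andP[/eqP -> _]//].
exact: ltn_trans nk.
Qed.

Lemma below_le_rank s n (k : nat) : (k <= s n)%N -> (#|below s k| <= rank s n)%N.
Proof.
move=> kn; apply: subset_leq_card; apply/fintype.subsetP => m; rewrite !inE => mk.
by rewrite (leq_trans mk kn).
Qed.

Lemma rank_lt s n : (rank s n < N)%N.
Proof.
apply: leq_trans (rank_lt_below (ltn_ord (s n))) _.
by rewrite -[X in (_ <= X)%N]card_ord max_card.
Qed.

Lemma rank_mono s m n : (s m < s n)%N || ((s m == s n) && (m < n)%N) -> (rank s m < rank s n)%N.
Proof.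
move=> mn; apply: proper_card; apply/properP; split; last first.
  by exists m; rewrite inE ?mn// eqxx !ltnn.
apply/fintype.subsetP => k; rewrite !inE.
move: mn => /orP[mn|/andP[/eqP <- mn]] /orP[km|/andP[/eqP km kn]].
- by rewrite (ltn_trans km mn).
- by rewrite km mn.
- by rewrite km.
- by rewrite km eqxx (ltn_trans kn mn) orbT.
Qed.

(** Ties are broken by label, so priority is a strict total order and the ranks permute ['I_N]. *)
Lemma rank_inj s : injective (fun n => Ordinal (rank_lt s n)).
Proof.
move=> m n /(congr1 val)/= E.
have H k l : rank s k = rank s l -> ~~ ((s k < s l)%N || ((s k == s l) && (k < l)%N)).
  by move=> kl; apply/negP => /rank_mono; rewrite kl ltnn.
have := H _ _ E; have := H _ _ (esym E); rewrite !negb_or -!leqNgt.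
move=> /andP[mn +] /andP[nm].
have -> : s m = s n by apply/val_inj/anti_leq; rewrite mn nm.
rewrite !eqxx/= -!leqNgt => nm' mn'.
by apply/val_inj/anti_leq; rewrite nm' mn'.
Qed.

Lemma card_ord_lt (k : nat) : (k <= N)%N -> #|[set r : 'I_N | (r < k)%N]| = k.
Proof.
move=> kN; have -> : [set r : 'I_N | (r < k)%N] = [set widen_ord kN r | r : 'I_k].
  apply/setP => r; rewrite inE; apply/idP/imsetP => [rk|[r' _ ->]]; last exact: (ltn_ord r').
  by exists (Ordinal rk) => //; exact: val_inj.
rewrite card_imset ?card_ord//.
by move=> a b /(congr1 val)/= ab; exact: val_inj.
Qed.

Lemma card_rank_lt s (k : nat) : (k <= N)%N -> #|[set n | (rank s n < k)%N]| = k.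
Proof.
move=> kN; rewrite -[RHS](card_ord_lt kN).
rewrite -[RHS](on_card_preimset (onW_bij _ (injF_bij (@rank_inj s)))).
by apply: eq_card => n; rewrite !inE.
Qed.

Lemma card_below_le s (k : nat) : (#|below s k| <= N)%N.
Proof. by rewrite -[X in (_ <= X)%N]card_ord max_card. Qed.

Lemma wip_actE (K : nat) s n : wip_act K s n = (rank s n < K)%N.
Proof.
rewrite ffunE; congr (_ < K)%N; apply: eq_card => m; rewrite [RHS]inE.
by apply/idP/idP; rewrite inE.
Qed.

(** The active set and [below s k] are both initial segments for the rank, so their intersection is
    the shorter one. *)
Lemma card_active_below (K : nat) s (k : nat) : 
  #|[set n in below s k | wip_act K s n]| = minn K #|below s k|.
Proof.
have M : (minn K #|below s k| <= N)%N by rewrite geq_min card_below_le orbT.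
rewrite -[RHS](card_rank_lt s M).
apply: eq_card => n; rewrite !inE wip_actE leq_min andbC; congr (_ && _).
by apply/idP/idP => [/rank_lt_below//|]; rewrite !ltnNge; apply: contra => /below_le_rank.
Qed.

Lemma below_top s : below s d = [set: 'I_N].
Proof. by apply/setP => n; rewrite !inE ltn_ord. Qed.

Lemma card_active (K : nat) s : (K <= N)%N -> #|[set n | wip_act K s n]| = K.
Proof.
move=> KN; have := card_active_below K s d; rewrite below_top cardsT card_ord.
by rewrite (minn_idPl KN) => E; rewrite -[RHS]E; apply: eq_card => n; rewrite !inE.
Qed.

(** The hypotheses say that [i] is the critical state of the configuration; the pairs of action and
    state that remain are those with equality in [whittle_bellman]. *)
Lemma wip_zone (K : nat) s (i : nat) n : (#|below s i| <= K)%N -> (K < #|below s i.+1|)%N ->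
  if wip_act K s n then (s n <= i)%N else (i <= s n)%N.
Proof.
rewrite wip_actE => H1 H2; case: ltnP => rk; rewrite leqNgt; apply/negP.
  by move=> /below_le_rank H; have := leq_trans H2 (leq_trans H (ltnW rk)); rewrite ltnn.
by move=> /rank_lt_below H; have := leq_trans H (leq_trans H1 rk); rewrite ltnn.
Qed.

Definition emp s i : R := #|[set n | s n == i]|%:R / N%:R.

Hypothesis N0 : (0 < N)%N.

Let N0R : (N%:R : R) != 0. Proof. by rewrite pnatr_eq0 -lt0n. Qed.

Lemma sum_below s (k : nat) (A : {set 'I_N}) :
  (#|[set n in below s k | n \in A]|%:R : R) =
  \sum_(i : 'I_d | (i < k)%N) #|[set n in A | s n == i]|%:R.
Proof.
rewrite -natr_sum; congr (_%:R).
rewrite -sum1_card (partition_big s (fun i : 'I_d => (i < k)%N))/=; last first.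
  by move=> n; rewrite !inE => /andP[].
apply: eq_bigr => i ik; rewrite sum1_card; apply: eq_card => n; rewrite !inE unfold_in/= !inE.
by case: eqP => [->|]; rewrite ?ik ?andbT ?andbF.
Qed.

Lemma cum_emp s (k : nat) : cum (emp s) k = #|below s k|%:R / N%:R.
Proof.
have := sum_below s k [set: 'I_N]; rewrite (_ : [set n in _ | _] = below s k); last first.
  by apply/setP => n; rewrite !inE andbT.
move=> ->; rewrite mulr_suml; apply: eq_bigr => i _; rewrite /emp.
by congr (_%:R / _); apply: eq_card => n; rewrite !inE.
Qed.

Lemma emp_simplex s : in_simplex (emp s).
Proof.
split=> [i|]; first by rewrite divr_ge0.
by rewrite -cum_total cum_emp below_top cardsT card_ord divff.
Qed.

Variables (alpha : R) (K : nat).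
Hypothesis alphaK : alpha * N%:R = K%:R.

Lemma active_emp s i : active_mass alpha (emp s) i =
  #|[set n | (s n == i) && wip_act K s n]|%:R / N%:R.
Proof.
pose g j : R := #|[set n in [set n | wip_act K s n] | s n == j]|%:R.
have minE k : Num.min alpha (cum (emp s) k) = cum g k / N%:R.
  rewrite /cum -sum_below (_ : [set n in _ | _] = [set n in below s k | wip_act K s n]); last first.
    by apply/setP => n; rewrite !inE.
  rewrite card_active_below -/(cum (emp s) k) cum_emp natr_min -alphaK.
  by rewrite -{1}(mulfK N0R alpha) minr_pMl// invr_ge0.
rewrite /active_mass !minE -mulrBl; congr (_ / _).
rewrite cumS addrC addKr /g; congr (_%:R).
by apply: eq_card => n; rewrite !inE andbC.
Qed.

(** The identity is exact, without a [1/N] correction, because the [K] active bandits fill exactly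
    the mass [alpha]; see [active_emp]. *)
Lemma drift_emp s j : \sum_n Q (wip_act K s n) (s n) j = N%:R * drift Q alpha (emp s) j.
Proof.
rewrite /drift mulr_sumr (partition_big s xpredT)//=; apply: eq_bigr => i _.
have cnt b : \sum_(n | (s n == i) && (wip_act K s n == b)) Q (wip_act K s n) (s n) j =
    #|[set n | (s n == i) && (wip_act K s n == b)]|%:R * Q b i j.
  rewrite (eq_bigr (fun=> Q b i j)); last by move=> n /andP[/eqP -> /eqP ->].
  by rewrite sumr_const mulr_natl; congr (_ *+ _); apply: eq_card => n; rewrite inE.
rewrite (bigID (fun n => wip_act K s n == true))/= cnt.
rewrite [X in _ + X](eq_bigl (fun n => (s n == i) && (wip_act K s n == false))); last first.
  by move=> n; case: (wip_act K s n).
rewrite cnt.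
have A1 : active_mass alpha (emp s) i = #|[set n | (s n == i) && (wip_act K s n == true)]|%:R / N%:R.
  by rewrite active_emp; congr (_%:R / _); apply: eq_card => n; rewrite !inE eqb_id.
have A2 : emp s i - active_mass alpha (emp s) i =
    #|[set n | (s n == i) && (wip_act K s n == false)]|%:R / N%:R.
  rewrite A1 /emp -mulrBl; congr (_ / _); apply/eqP; rewrite subr_eq addrC -natrD eqr_nat.
  rewrite -(cardsID [set n | wip_act K s n == true] [set n | s n == i]); apply/eqP.
  by congr addn; apply: eq_card => n; rewrite !inE// andbC; case: (wip_act K s n).
rewrite A2 A1; move: (Q true i j) (Q false i j) => u v.
by rewrite ![_ / _ * _]mulrAC -mulrDl [RHS]mulrC divfK.
Qed.

Lemma emp_move s n i j : j != s n ->
  emp (move s n j) i = emp s i + ((i == j)%:R - (i == s n)%:R) / N%:R.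
Proof.
move=> jn; rewrite /emp -mulrDl; congr (_ / _).
have cnt s' : (#|[set k | s' k == i]|%:R : R) = \sum_(k : 'I_N) (s' k == i)%:R.
  rewrite -sum1_card natr_sum big_mkcond/=; apply: eq_bigr => k _.
  by rewrite inE; case: eqP.
rewrite !cnt (bigD1 n)//= ffunE eqxx [X in _ = X + _](bigD1 n)//=.
rewrite (eq_bigr (fun k => (s k == i)%:R)); last first.
  by move=> k kn; rewrite ffunE (negbTE kn).
by rewrite (eq_sym i j) (eq_sym i (s n)); ring.
Qed.

End Bandits.

(** * Concentration around the fluid trajectory *)

Lemma le_of_eq (R : realType) (a b : R) : a = b -> a <= b.
Proof. by move=> ->. Qed.

(** From [expR z * (1 - z) <= 1] and [(1 + z + 2 z^2) (1 - z) = 1 + z^2 (1 - 2 z) >= 1]. *)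
Lemma expR_quadratic (R : realType) (z : R) : `|z| <= 2^-1 -> expR z - 1 <= z + 2 * z ^+ 2.
Proof.
rewrite ler_norml => /andP[z1 z2].
have z0 : 0 < 1 - z by lra.
rewrite lerBlDr -(ler_pM2r z0); apply: (@le_trans _ _ 1).
  rewrite -[leRHS](expRxMexpNx_1 z) ler_wpM2l ?expR_ge0//.
  exact: expR_ge1Dx.
have -> : (z + 2 * z ^+ 2 + 1) * (1 - z) = 1 + z ^+ 2 * (1 - 2 * z) by ring.
by rewrite lerDl mulr_ge0 ?sqr_ge0//; lra.
Qed.

(** Gronwall's argument: [expR (- C t)] times the expectation of [u t] is nonincreasing. *)
Lemma expo_lyapunov (R : realType) (X : finType) (G : X -> X -> R) (D : pred X)
    (u du : R -> X -> R) (C T : R) x : generator G -> closed_under G D -> D x -> 0 <= T ->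
  (forall (t : R) y, 0 <= t -> is_derive t 1 (fun s => u s y) (du t y)) ->
  (forall t y, 0 <= t -> D y -> app G (u t) y + du t y <= C * u t y) ->
  expo G T (u T) x <= expR (C * T) * u 0 x.
Proof.
move=> genG HD Dx T0 Hd Hle.
pose v (t : R) := expR (- (C * t)) * expo G t (u t) x.
pose w (t : R) y := app G (u t) y + du t y.
pose dv (t : R) := expR (- (C * t)) * (expo G t (w t) x - C * expo G t (u t) x).
have dvP t : 0 <= t <= T -> is_derive t 1 v (dv t).
  move=> /andP[t0 _].
  have H1 : is_derive t 1 (fun s : R => - (C * s)) (- (C * 1)).
    by apply: derN; apply: derZ; exact: der_id.
  have H2 := @der_expo _ _ G t u (du t) x (fun y => Hd t y t0).
  apply: is_derive_eq (derM (der_expR H1) H2) _.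
  by rewrite /dv /w mulr1; ring.
have dv0 t : 0 <= t <= T -> 0 <= - dv t.
  move=> /andP[t0 _]; rewrite /dv -mulrN mulr_ge0 ?expR_ge0// oppr_ge0 subr_le0.
  have := expo_mono genG HD t0 Dx (fun y Dy => Hle t y t0 Dy).
  by rewrite {2}/expo appZ.
have := @der_le R (fun t => - v t) (fun t => - dv t) T T0 _ dv0.
have dN t : 0 <= t <= T -> is_derive t 1 (fun t => - v t) (- dv t).
  by move=> tT; apply: derN; exact: dvP.
move=> /(_ dN); rewrite lerN2 /v mulr0 oppr0 expR0 mul1r expo0 expRN.
by rewrite ler_pdivrMl ?expR_gt0.
Qed.

Lemma simplex_le1 (R : realType) (d : nat) (m : 'I_d -> R) i : in_simplex m -> m i <= 1.
Proof. by move=> [m0 <-]; rewrite (bigD1 i)//= lerDl sumr_ge0. Qed.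

Section Concentration.
Variables (R : realType) (N d : nat) (Q : bool -> 'I_d -> 'I_d -> R) (alpha : R) (K : nat).
Hypothesis genQ : forall a, is_generator (Q a).
Hypothesis N0 : (0 < N)%N.
Hypothesis alphaK : alpha * N%:R = K%:R.
Variable x : R -> 'I_d -> R.
Hypothesis x_simplex : forall t, 0 <= t -> in_simplex (x t).
Hypothesis dx : forall (t : R) i, 0 <= t -> is_derive t 1 (fun u => x u i) (drift Q alpha (x t) i).

Implicit Types (t : R) (s : bstate N d) (i j : 'I_d).
Let G := bgen Q (@wip_pol R N d K).
Let genG : generator G := generator_bgen genQ (wip_pol_policy R K).
Let r : R := N%:R^-1.
Let r0 : 0 < r. Proof. by rewrite invr_gt0 ltr0n. Qed.
Let r1 : r <= 1. Proof. by rewrite invf_le1 ?ltr0n// ler1n. Qed.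
Let Nr : N%:R * r = 1. Proof. by rewrite divff// pnatr_eq0 -lt0n. Qed.

Definition deviation t s i : R := emp R s i - x t i.
Definition sq_dist t s : R := \sum_i deviation t s i ^+ 2.

Lemma deviation_bound t s i : 0 <= t -> -1 <= deviation t s i <= 1.
Proof.
move=> t0; rewrite /deviation.
have es := emp_simplex R N0 s; have xs := x_simplex t0.
have := es.1 i; have := xs.1 i; have := simplex_le1 i es; have := simplex_le1 i xs.
by lra.
Qed.

Lemma sq_dist_move t s n j : j != s n ->
  sq_dist t (move s n j) =
  sq_dist t s + 2 * r * (deviation t s j - deviation t s (s n)) + 2 * r ^+ 2 /\
  deviation t s j ^+ 2 + deviation t s (s n) ^+ 2 <= sq_dist t s.
Proof.
move=> jn; have nj : s n != j by rewrite eq_sym.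
rewrite /sq_dist (bigD1 j)//= (bigD1 (s n))//=.
rewrite [\sum_(i < d) deviation t s i ^+ 2](bigD1 j)//= [\sum_(i < d | i != j) deviation t s i ^+ 2](bigD1 (s n))//=.
rewrite (eq_bigr (fun i => deviation t s i ^+ 2)); last first.
  move=> i /andP[ij isn]; rewrite /deviation emp_move// (negbTE ij) (negbTE isn).
  by rewrite subrr mul0r addr0.
rewrite /deviation !emp_move// eqxx (negbTE jn) eqxx (negbTE nj) -/r /= mulr1n mulr0n; split; first by ring.
by rewrite addrA lerDl sumr_ge0// => i _; rewrite sqr_ge0.
Qed.

Lemma jump_bound t s n j (h : R) : 0 <= t -> 0 <= h <= 12^-1 -> j != s n ->
  expR (N%:R * h * sq_dist t (move s n j)) - expR (N%:R * h * sq_dist t s) <=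
  expR (N%:R * h * sq_dist t s) *
   (2 * h * (deviation t s j - deviation t s (s n)) + (3 * h * sq_dist t s + 4 * h * r)).
Proof.
move=> t0 /andP[h0 h1] jn; have [-> le] := sq_dist_move t jn.
set a := deviation t s j in le *; set b := deviation t s (s n) in le *.
set W := sq_dist t s in le *.
have /andP[a1 a2] : -1 <= a <= 1 by exact: deviation_bound.
have /andP[b1 b2] : -1 <= b <= 1 by exact: deviation_bound.
pose z := 2 * h * (a - b + r).
have -> : N%:R * h * (W + 2 * r * (a - b) + 2 * r ^+ 2) = N%:R * h * W + z.
  transitivity (N%:R * h * W + (N%:R * r) * z); last by rewrite Nr mul1r.
  by rewrite /z; ring.
rewrite expRD -[X in _ - X]mulr1 -mulrBr ler_wpM2l ?expR_ge0//.
(* The bound [h <= 12^-1] is chosen for this: [|a - b + r| <= 3] gives [|z| <= 2 * 12^-1 * 3]. *)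
have zb : `|z| <= 2^-1.
  rewrite /z normrM ger0_norm ?mulr_ge0//; apply: (@le_trans _ _ (2 * 12^-1 * 3)); last by lra.
  have : `|a - b + r| <= 3 by rewrite ler_norml; move: r0 r1 => ? ?; lra.
  by move=> H; apply: ler_pM => //; rewrite ?mulr_ge0// ler_wpM2l.
apply: le_trans (expR_quadratic zb) _.
have rr : r ^+ 2 <= r by rewrite expr2 -[leRHS]mulr1 ler_wpM2l// ltW.
have sq : (a - b + r) ^+ 2 <= 4 * W + 2 * r.
  have := sqr_ge0 (a - b - r); have := sqr_ge0 (a + b); rewrite !expr2 in rr le *; nra.
have : z ^+ 2 <= 4 * h * 12^-1 * (4 * W + 2 * r).
  rewrite /z exprMn; apply: ler_pM; rewrite ?sqr_ge0//.
  have hh : h * h <= h * 12^-1 by rewrite ler_wpM2l.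
  by rewrite expr2; lra.
have W0 : 0 <= W by rewrite /W sumr_ge0// => i _; rewrite sqr_ge0.
have hW : 0 <= h * W by rewrite mulr_ge0.
have hr : 0 <= h * r by rewrite mulr_ge0// ltW.
(* Here [z^2 <= (4/3) h W + (2/3) h r], so the terms beyond [2 h (a - b)] are at most
   [(8/3) h W + (10/3) h r], rounded up to 3 and 4. *)
rewrite /z => H; lra.
Qed.

(** The linear parts of [jump_bound] sum to the pairing of the deviation with the drift by
    [drift_emp]; the remainders are multiplied by a jump rate of at most [tau Q] per bandit. *)
Lemma app_exp_sq_dist t (h : R) y : 0 <= t -> 0 <= h <= 12^-1 -> wip_states K y ->
  app G (fun y => expR (N%:R * h * sq_dist t y.1)) y <=
  expR (N%:R * h * sq_dist t y.1) *
   (2 * h * (N%:R * \sum_j deviation t y.1 j * drift Q alpha (emp R y.1) j) +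
    N%:R * tau Q * (3 * h * sq_dist t y.1 + 4 * h * r)).
Proof.
move=> t0 hh /eqP ya; have /andP[h0 _] := hh.
rewrite (app_bgen_state genQ (wip_pol_policy R K) (fun s => expR (N%:R * h * sq_dist t s))).
set s := y.1; set F := expR (N%:R * h * sq_dist t s).
set c := 3 * h * sq_dist t s + 4 * h * r.
have c0 : 0 <= c.
  by rewrite addr_ge0 ?mulr_ge0 ?(ltW r0)// sumr_ge0// => i _; rewrite sqr_ge0.
pose dv := deviation t s.
apply: (@le_trans _ _ (\sum_n F * (2 * h * app (Q (y.2 n)) dv (s n) + tau Q * c))).
  apply: ler_sum => n _.
  rewrite (app_generator (genQ (y.2 n))) mulrDr mulrCA !mulr_sumr.
  apply: (@le_trans _ _ (\sum_(j | j != s n)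
     (2 * h * (F * (Q (y.2 n) (s n) j * (dv j - dv (s n)))) + F * c * Q (y.2 n) (s n) j))).
    apply: ler_sum => j jn.
    have q0 : 0 <= Q (y.2 n) (s n) j by apply: (rate_ge0 genQ); rewrite eq_sym.
    apply: le_trans (ler_wpM2l q0 (jump_bound t0 hh jn)) _.
    by rewrite -/F -/c -/dv; apply: le_of_eq; rewrite /dv; ring.
  rewrite big_split/= lerD// -mulr_sumr.
  rewrite -mulrA ler_wpM2l ?expR_ge0// [leLHS]mulrC ler_wpM2r//.
  exact: (row_sum_le genQ).
rewrite -mulr_sumr ler_wpM2l ?expR_ge0// big_split/= -mulr_sumr sumr_const card_ord
  -[_ *+ N]mulr_natl [N%:R * (tau Q * c)]mulrA lerD2r.
rewrite ler_wpM2l ?mulr_ge0//; apply: le_of_eq; rewrite /app exchange_big/= mulr_sumr.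
apply: eq_bigr => j _; rewrite -mulr_suml ya mulrCA mulrC; congr (_ * _).
exact: (drift_emp Q N0 alphaK).
Qed.

(* Compensates the growth rates of [sq_dist] in [deviation_drift] and
   [app_exp_sq_dist], so that only a bounded term remains in the drift of
   [expR (N * weight t * sq_dist t)]. *)
Definition contraction_rate : R := 2 * lip_const Q * d%:R + 3 * tau Q.
Definition weight t : R := 12^-1 * expR (- (contraction_rate * t)).

Lemma deviation_drift t s :
  \sum_j deviation t s j * (drift Q alpha (emp R s) j - drift Q alpha (x t) j) <=
  lip_const Q * d%:R * sq_dist t s.
Proof.
pose D i := `|deviation t s i|.
apply: (@le_trans _ _ (\sum_j D j * (lip_const Q * \sum_i D i))).
  apply: ler_sum => j _; apply: le_trans (ler_norm _) _; rewrite normrM ler_wpM2l//.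
  exact: drift_lipschitz.
rewrite -mulr_suml mulrCA -mulrA ler_wpM2l ?lip_const_ge0//.
have DD i j : D i * D j <= 2^-1 * (D i ^+ 2 + D j ^+ 2).
  by have := sqr_ge0 (D i - D j); rewrite !expr2; nra.
rewrite mulr_suml; apply: (@le_trans _ _ (\sum_i \sum_j 2^-1 * (D i ^+ 2 + D j ^+ 2))).
  by apply: ler_sum => i _; rewrite mulr_sumr; apply: ler_sum => j _.
have DW : \sum_j D j ^+ 2 = sq_dist t s.
  by apply: eq_bigr => j _; rewrite /D real_normK// num_real.
have E i : \sum_j 2^-1 * (D i ^+ 2 + D j ^+ 2) = 2^-1 * (d%:R * D i ^+ 2 + sq_dist t s).
  by rewrite -mulr_sumr big_split/= DW sumr_const card_ord -[_ *+ d]mulr_natl.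
rewrite (eq_bigr _ (fun i _ => E i)) -mulr_sumr big_split/= -mulr_sumr DW.
rewrite sumr_const card_ord -[sq_dist t s *+ d]mulr_natl.
by apply: le_of_eq; field.
Qed.

(** The fluid path starts at the empirical measure of [y], so the Lyapunov function starts at 1 and
    the bound depends neither on [N] nor on [y]. *)
Lemma wip_concentration (T : R) y : 0 <= T -> wip_states K y -> x 0 = emp R y.1 ->
  expo G T (fun y => expR (N%:R * weight T * sq_dist T y.1)) y <= expR (tau Q * T).
Proof.
move=> T0 Dy x0.
pose u t (y : bstate N d * bact N) := expR (N%:R * weight t * sq_dist t y.1).
pose dW t s := \sum_i 2 * deviation t s i * - drift Q alpha (x t) i.
pose du t (y : bstate N d * bact N) := u t y *
  (N%:R * (- contraction_rate * weight t) * sq_dist t y.1 + N%:R * weight t * dW t y.1).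
have [i0|noi] := pickP (fun _ : 'I_d => true); last first.
  have := (emp_simplex R N0 y.1).2; rewrite big_pred0 => [/eqP|i]; last by have := noi i.
  by rewrite eq_sym oner_eq0.
move=> _; have tau0 : 0 <= tau Q := tau_ge0 Q i0.
have w0 t : 0 <= weight t by rewrite mulr_ge0 ?expR_ge0.
have kap0 : 0 <= contraction_rate.
  have := lip_const_ge0 Q; rewrite /contraction_rate => l0.
  by rewrite addr_ge0// mulr_ge0// mulr_ge0.
have w1 t : 0 <= t -> weight t <= 12^-1.
  move=> t0; rewrite /weight -[leRHS]mulr1 ler_wpM2l// -expR0 ler_expR.
  by rewrite oppr_le0 mulr_ge0.
have dweight t : is_derive t 1 weight (- contraction_rate * weight t).
  have H1 : is_derive t 1 (fun s : R => - (contraction_rate * s)) (- (contraction_rate * 1)).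
    by apply: derN; apply: derZ; exact: der_id.
  by apply: is_derive_eq (derZ 12^-1 (der_expR H1)) _; rewrite /weight mulr1; ring.
have dsq t s : 0 <= t -> is_derive t 1 (fun t => sq_dist t s) (dW t s).
  move=> t0; apply: der_sum => i; apply: derX2.
  by have := derB (der_cst t (emp R s i)) (dx i t0); rewrite sub0r.
have Hd t z : 0 <= t -> is_derive t 1 (fun r : R => u r z) (du t z).
  move=> t0; have := der_expR (derM (derZ N%:R (dweight t)) (dsq t z.1 t0)).
  by move=> H; apply: is_derive_eq H _; rewrite /du mulrA.
have := @expo_lyapunov R _ G (wip_states K) u du (tau Q) T y genG (@wip_closed R N d Q K) Dy T0 Hd.
have u0 : u 0 y = 1.
  rewrite /u (_ : sq_dist 0 y.1 = 0) ?mulr0 ?expR0// /sq_dist big1// => i _.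
  by rewrite /deviation x0 subrr expr0n.
rewrite u0 mulr1; apply=> t z t0 Dz.
have := app_exp_sq_dist t0 (introT andP (conj (w0 t) (w1 t t0))) Dz.
rewrite -/(u t) -/(u t z) /du => H.
rewrite [tau Q * _]mulrC; set W := sq_dist t z.1 in H *; set h := weight t in H *.
apply: le_trans (lerD H (lexx _)) _; rewrite -mulrDr ler_wpM2l ?expR_ge0//.
have := deviation_drift t z.1; rewrite -/W.
under eq_bigr do rewrite mulrBr.
rewrite sumrB; set A := \sum_j _ * _; set B := \sum_j _ * _ => AB.
have -> : dW t z.1 = - 2 * B.
  by rewrite /dW /B mulr_sumr; apply: eq_bigr => i _; ring.
have h0 : 0 <= h by exact: w0.
have h1 : h <= 12^-1 by exact: w1.
have Nh : 0 <= N%:R * h by rewrite mulr_ge0// ltW.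
have HH := ler_wpM2l Nh AB.
(* The only term not absorbed by the decay of the weight: [N] bandits times [r = 1/N] leave
   [4 tau h], and [h <= 12^-1]. *)
have E : N%:R * tau Q * (4 * h * r) = 4 * tau Q * h.
  by transitivity (4 * tau Q * h * (N%:R * r)); [ring|rewrite Nr mulr1].
rewrite mulrDr E /contraction_rate.
have T4 : 4 * tau Q * h <= tau Q.
  have : tau Q * h <= tau Q * 12^-1 by rewrite ler_wpM2l.
  lra.
move: HH; set NN := N%:R; lra.
Qed.

End Concentration.

(** * Bellman gaps *)

Section Gap.
Variables (R : realType) (N d : nat) (Q : bool -> 'I_d -> 'I_d -> R) (Rw : bool -> 'I_d -> R).
Hypothesis genQ : forall a, is_generator (Q a).
Variables (nu g : R) (h : 'I_d -> R).

Definition gap a i : R := g - sub_reward Rw nu a i - \sum_j Q a i j * h j.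

Definition total_gap (x : bstate N d * bact N) : R := \sum_n gap (x.2 n) (x.1 n).

Variable pol : bstate N d -> bact N -> R.
Hypothesis polP : is_rpolicy pol.

(** The sum over the bandits of the definition of [gap]; the passive subsidy totals [nu] times the
    number of bandits that are not active. *)
Lemma breward_gap x : breward Rw x = (N%:R * (g - nu) + nu * bactive R x) +
  (-1 * app (bgen Q pol) (fun y => \sum_n h (y.1 n)) x + -1 * total_gap x).
Proof.
rewrite (app_bgen_state genQ polP (fun s => \sum_n h (s n))).
have -> : \sum_n \sum_(j | j != x.1 n) Q (x.2 n) (x.1 n) j *
    (\sum_k h (move x.1 n j k) - \sum_k h (x.1 k)) =
  \sum_n \sum_j Q (x.2 n) (x.1 n) j * h j.
  apply: eq_bigr => n _; rewrite -/(app (Q (x.2 n)) h (x.1 n)).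
  rewrite (app_generator (genQ (x.2 n))); apply: eq_bigr => j _; congr (_ * _).
  rewrite (bigD1 n)//= [X in _ - X](bigD1 n)//= ffunE eqxx.
  rewrite (eq_bigr (fun k => h (x.1 k))); first by ring.
  by move=> k kn; rewrite ffunE (negbTE kn).
rewrite /bactive natr_sum /breward /total_gap !mulN1r -!sumrN mulr_sumr.
rewrite mulr_natl -[X in _ *+ X]card_ord -sumr_const -!big_split/=.
apply: eq_bigr => n _; rewrite /gap /sub_reward.
by case: (x.2 n); rewrite ?mulr1 ?mulr0; ring.
Qed.

Lemma lr_avg_breward mu : \sum_x mu x = 1 ->
  lr_avg (bgen Q pol) mu (breward Rw) =
  N%:R * (g - nu) + nu * lr_avg (bgen Q pol) mu (@bactive R N d)
  - lr_avg (bgen Q pol) mu total_gap.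
Proof.
move=> mu1; have gen := generator_bgen genQ polP.
have -> : breward Rw = fun x => (N%:R * (g - nu) + nu * bactive R x) +
  (-1 * app (bgen Q pol) (fun y => \sum_n h (y.1 n)) x + -1 * total_gap x).
  by apply/funext => x; exact: breward_gap.
rewrite !(lr_avgD gen) !(lr_avgZ gen) (lr_avg_cst gen _ mu1) lr_avg_app//.
by rewrite mulr0 add0r mulN1r.
Qed.

End Gap.

(** * From the nonsingular fixed point to the exponential estimate *)

Lemma nonsingular_margin (R : realType) (d : nat) (alpha : R) (m : 'I_d -> R) :
  0 < alpha < 1 -> in_simplex m -> ~ singular alpha m ->
  exists (s : 'I_d) (e : R), 0 < e /\ forall m' : 'I_d -> R,
    (forall i, `|m' i - m i| <= e) -> cum m' s <= alpha < cum m' s.+1.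
Proof.
move=> a01 ms nsing; have [s [_ H1 H2]] := sidx_exists ms a01.
have lt1 : cum m s < alpha.
  rewrite lt_neqAle H1 andbT; apply/eqP => E.
  (* Singularity is about sums over [j <= i], so [cum m s = alpha] is excluded through [i = s - 1],
     and for [s = 0] through [alpha > 0]. *)
  move: E; case Es : (s : nat) => [|k]; first by rewrite cum0; move: a01; lra.
  have kd : (k < d)%N by rewrite ltnW// -Es.
  by move=> E; apply: nsing; exists (Ordinal kd); rewrite -E.
have d0 : 0 < (d%:R : R) by rewrite ltr0n; case: d s {lt1 H1 H2 nsing ms m} => // -[].
pose e := Num.min (alpha - cum m s) (cum m s.+1 - alpha) / (2 * d%:R).
exists s, e; split.
  by rewrite divr_gt0 ?mulr_gt0// lt_min !subr_gt0 lt1.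
move=> m' Hm.
have B k : `|cum m' k - cum m k| <= Num.min (alpha - cum m s) (cum m s.+1 - alpha) / 2.
  apply: le_trans (cum_lipschitz _ _ _) _.
  apply: (@le_trans _ _ (\sum_(i < d) e)); first exact: ler_sum.
  rewrite sumr_const card_ord -[e *+ d]mulr_natl /e; apply: le_of_eq.
  by field; rewrite gt_eqF.
have := B s; have := B s.+1; rewrite !ler_norml.
case: (leP (alpha - cum m s)); lra.
Qed.

(** Since [c u <= expR (c u)], giving up half of the rate absorbs the linear factor. *)
Lemma linear_expR_le (R : realType) (c u : R) : 0 < c -> u * expR (- (2 * c * u)) <= c^-1 * expR (- (c * u)).
Proof.
move=> c0; have -> : - (2 * c * u) = - (c * u) + - (c * u) by ring.
rewrite expRD mulrA ler_wpM2r ?expR_ge0// -(ler_pM2l c0) mulrA mulfV ?gt_eqF//.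
rewrite -(expRxMexpNx_1 (c * u)) ler_wpM2r ?expR_ge0//.
by have := expR_ge1Dx (c * u); lra.
Qed.

Section WipGap.
Variables (R : realType) (d : nat) (Q : bool -> 'I_d -> 'I_d -> R) (Rw : bool -> 'I_d -> R).
Variables (alpha : R) (mstar : 'I_d -> R).
Hypothesis genQ : forall a, is_generator (Q a).
Hypothesis a01 : 0 < alpha < 1.
Hypothesis mstar_simplex : in_simplex mstar.
Hypothesis attr : uniform_attractor Q alpha mstar.

(** Markov's inequality for the exponential moment of [wip_concentration]. [T] and the constants are
    fixed before [N], [K] and [y]. *)
Lemma wip_zone_concentration (s : 'I_d) (e : R) : 0 < e ->
  (forall m : 'I_d -> R, (forall i, `|m i - mstar i| <= e) -> cum m s <= alpha < cum m s.+1) ->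
  exists b c T : R, [/\ 0 < b, 0 < c, 0 <= T &
    forall (N K : nat) (y : bstate N d * bact N),
    (0 < N)%N -> alpha * N%:R = K%:R -> wip_states K y ->
    expo (bgen Q (@wip_pol R N d K)) T
      (fun y => (~~ (#|below y.1 s| <= K < #|below y.1 s.+1|)%N)%:R) y
    <= b * expR (- (c * N%:R))].
Proof.
(* Half of the margin is for the fluid path to reach [mstar], half for the deviation from that
   path. *)
move=> e0 margin; pose e2 := e / 2.
have e20 : 0 < e2 by rewrite divr_gt0.
have [T1 HT] := attr e20; pose T := Num.max T1 0.
have T0 : 0 <= T by rewrite le_max lexx orbT.
have T1T : T1 <= T by rewrite le_max lexx.
pose c := weight Q T * e2 ^+ 2.
exists (expR (tau Q * T)), c, T; split=> //; first exact: expR_gt0.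
  by rewrite !mulr_gt0 ?expR_gt0 ?exprn_gt0.
move=> N K y N0 alphaK Dy.
have [x [x0 xs dx]] := fluid_solution alpha genQ (emp_simplex R N0 y.1).
have genG := generator_bgen genQ (wip_pol_policy R (N := N) (d := d) K).
have near i : `|x T i - mstar i| <= e2.
  apply: (HT _ (emp_simplex R N0 y.1) x x0 xs) => // t j t0.
  by rewrite -drift_phi//; [exact: dx | exact: xs].
have C := wip_concentration genQ N0 alphaK xs dx T0 Dy x0.
set F := (fun y => _) in C.
apply: (@le_trans _ _ (expo (bgen Q (@wip_pol R N d K)) T (fun y => expR (- (c * N%:R)) * F y) y)).
  (* Pointwise comparison: on the bad event some coordinate deviates by more than [e2], hence
     [F z >= expR (c N)]. *)
  apply: (expo_mono genG (@wip_closed R N d Q K) T0 Dy) => z _ {Dy C}.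
  have Fz : 0 <= expR (- (c * N%:R)) * F z by rewrite mulr_ge0// expR_ge0.
  case Z: (_ <= _ < _)%N => //=.
  rewrite /F -expRD -[leLHS]expR0 ler_expR.
  have : e2 ^+ 2 <= sq_dist x T z.1.
    rewrite leNgt; apply/negP => W; move: Z; rewrite -(ltr_nat R) -(ler_nat R).
    have N0R : 0 < (N%:R : R) by rewrite ltr0n.
    have := margin (emp R z.1); rewrite !cum_emp// ler_pdivrMr// ltr_pdivlMr// alphaK.
    move=> -> // i.
    have D1 : deviation x T z.1 i ^+ 2 <= e2 ^+ 2.
      apply: le_trans (ltW W); rewrite /sq_dist (bigD1 i)//= lerDl.
      by apply: sumr_ge0 => j _; rewrite sqr_ge0.
    have D2 : `|deviation x T z.1 i| <= e2.
      by rewrite -(ler_pXn2r (n := 2))// ?nnegrE ?(ltW e20)// real_normK ?num_real.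
    have := near i; move: D2; rewrite /deviation !ler_norml /e2 => /andP[? ?] /andP[? ?].
    by apply/andP; split; lra.
  have w0 : 0 <= weight Q T * N%:R by rewrite !mulr_ge0 ?expR_ge0.
  move=> /(ler_wpM2l w0) H; rewrite addrC subr_ge0; apply: le_trans (le_trans H _).
    by rewrite /c; apply: le_of_eq; ring.
  by apply: le_of_eq; ring.
by rewrite {1}/expo appZ mulrC ler_wpM2r ?expR_ge0.
Qed.

End WipGap.

(** This admits the Whittle policy among the competitors in [Vrel]. *)
Lemma lr_avg_bactive_wip (R : realType) (N d K : nat) (Q : bool -> 'I_d -> 'I_d -> R)
    (s0 : bstate N d) : (forall a, is_generator (Q a)) -> (K <= N)%N ->
  lr_avg (bgen Q (@wip_pol R N d K)) (binit (@wip_pol R N d K) s0) (@bactive R N d) = K%:R.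
Proof.
move=> genQ KN; set pol := @wip_pol R N d K.
have polP : is_rpolicy pol := wip_pol_policy R K.
have genG := generator_bgen genQ polP.
have mu0 := binit_ge0 polP s0; have muD := @binit_wip R N d K s0.
have HD := @wip_closed R N d Q K.
have E (y : bstate N d * bact N) : wip_states K y -> bactive R y = K%:R.
  move=> /eqP yE; rewrite /bactive yE; congr (_%:R).
  rewrite -[RHS](card_active y.1 KN) -sum1_card [RHS]big_mkcond.
  by apply: eq_bigr => n _; rewrite inE; case: (wip_act K y.1 n).
rewrite -[RHS](lr_avg_cst genG K%:R (binit_sum polP s0)).
by apply/le_anti/andP; split; apply: (lr_avg_mono genG HD mu0 muD) => y /E ->.
Qed.

Theorem theorem3 (R : realType) (d : nat) (Q : bool -> 'I_d -> 'I_d -> R)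
    (Rw : bool -> 'I_d -> R) (alpha : R) (mstar : 'I_d -> R) :
  is_generator (Q false) -> is_generator (Q true) ->
  0 < alpha < 1 ->
  (* (i) unichain and strictly indexable, states labelled by decreasing index *)
  unichain Q ->
  indexable Q Rw ->
  (forall i j : 'I_d, (i < j)%N -> whittle Q Rw j < whittle Q Rw i) ->
  (* (ii) mstar is the fixed point and a uniform global attractor *)
  in_simplex mstar -> phi Q alpha mstar = mstar ->
  uniform_attractor Q alpha mstar ->
  (* (iii) mstar is not singular *)
  ~ singular alpha mstar ->
  exists b c : R, 0 < b /\ 0 < c /\
    forall (N K : nat), (0 < N)%N -> alpha * N%:R = K%:R ->
    forall s0 : bstate N d,
      0 <= Vrel Q Rw alpha s0 - Vwip Q Rw K s0 /\
      Vrel Q Rw alpha s0 - Vwip Q Rw K s0 <= b * expR (- (c * N%:R)).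
Proof.
move=> gen0 gen1 a01 uni idx decr ms _ attr nsing.
have genQ a : is_generator (Q a) by case: a.
have [s [e [e0 margin]]] := nonsingular_margin a01 ms nsing.
have [b1 [c1 [T [b10 c10 T0 conc]]]] := wip_zone_concentration genQ a01 attr e0 margin.
have [g [h [bell act pas]]] := whittle_bellman genQ uni idx decr s.
set nu := whittle Q Rw s in bell act pas.
pose gp := gap Q Rw nu g h.
have gp0 a i : 0 <= gp a i by rewrite /gp /gap; have := bell a i; lra.
pose Cg := \sum_i (gp true i + gp false i).
have Cg0 : 0 <= Cg by apply: sumr_ge0 => i _; rewrite addr_ge0.
have gpC a i : gp a i <= Cg.
  rewrite /Cg (bigD1 i)//= -addrA; have := gp0 true i; have := gp0 false i.
  have : 0 <= \sum_(j | j != i) (gp true j + gp false j).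
    by apply: sumr_ge0 => j _; rewrite addr_ge0.
  by case: a; lra.
(* Half of the rate pays for the factor [N]; the [+ 1] below keeps the constant positive even if all
   gaps are zero. *)
pose c := c1 / 2; have c0 : 0 < c by rewrite divr_gt0.
exists (Cg * b1 * c^-1 + 1), c; split; last split=> //.
  by rewrite ltr_wpDl// !mulr_ge0// ?invr_ge0 ltW.
move=> N K N0 alphaK s0.
have N0R : 0 < (N%:R : R) by rewrite ltr0n.
have KN : (K <= N)%N.
  by rewrite -(ler_nat R) -alphaK -[leRHS]mul1r ler_wpM2r ?ler0n//; move: a01; lra.
pose U : R := N%:R * (g - nu) + nu * (alpha * N%:R).
have value (pol : bstate N d -> bact N -> R) : is_rpolicy pol ->
    lr_avg (bgen Q pol) (binit pol s0) (@bactive R N d) = alpha * N%:R ->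
    lr_avg (bgen Q pol) (binit pol s0) (breward Rw) =
    U - lr_avg (bgen Q pol) (binit pol s0) (@total_gap R N d Q Rw nu g h).
  move=> polP A; rewrite (lr_avg_breward Rw genQ nu g h polP) ?A//.
  exact: binit_sum.
have tg0 x : 0 <= @total_gap R N d Q Rw nu g h x by apply: sumr_ge0 => n _; exact: gp0.
have wpP := wip_pol_policy R (N := N) (d := d) K.
have wact : lr_avg (bgen Q (@wip_pol R N d K)) (binit (@wip_pol R N d K) s0) (@bactive R N d)
    = alpha * N%:R by rewrite lr_avg_bactive_wip.
rewrite /Vrel /Vwip; set S := (X in sup X); set vw := lr_avg _ _ _.
have Svw : S vw by exists (@wip_pol R N d K).
have SU : ubound S U.
  move=> v [pol [polP [A ->]]]; rewrite value// lerBlDr lerDl.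
  apply: (lr_avg_ge0 (generator_bgen genQ polP) (D := xpredT)) => //.
  by move=> x; exact: binit_ge0.
have vwE := value _ wpP wact; rewrite -/vw in vwE.
(* The member [vw] and the bound [U] make [sup S] a true supremum. *)
have supU : sup S <= U by apply: ge_sup => //; exists vw.
have vwS : vw <= sup S by apply: ub_le_sup => //; exists U.
split; first by rewrite subr_ge0.
have genG := generator_bgen genQ wpP.
pose bad (y : bstate N d * bact N) : R := (~~ (#|below y.1 s| <= K < #|below y.1 s.+1|)%N)%:R.
have mu0 := binit_ge0 wpP s0; have muD := @binit_wip R N d K s0.
have HD := @wip_closed R N d Q K.
have G1 : lr_avg (bgen Q (@wip_pol R N d K)) (binit (@wip_pol R N d K) s0)
    (@total_gap R N d Q Rw nu g h) <= N%:R * Cg * (b1 * expR (- (c1 * N%:R))).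
  apply: (@le_trans _ _ (lr_avg (bgen Q (@wip_pol R N d K)) (binit (@wip_pol R N d K) s0)
     (fun y => N%:R * Cg * bad y))).
    apply: (lr_avg_mono genG HD mu0 muD) => y /eqP yE.
    rewrite /bad; case Z: (_ <= _ < _)%N => /=; last first.
      rewrite mulr1 mulr_natl -[X in _ *+ X](card_ord N) -sumr_const.
      by apply: ler_sum => n _; exact: gpC.
    rewrite mulr0 /total_gap big1// => n _; rewrite yE.
    have /andP[Z1 Z2] := Z; have := wip_zone n Z1 Z2.
    rewrite /gap; case: (wip_act K y.1 n) => H.
      by rewrite -(act _ H); ring.
    by rewrite -(pas _ H); ring.
  (* Time shift: [bad] is replaced by its expectation after time [T], which [conc] bounds from every
     Whittle pair. *)
  rewrite (lr_avgZ genG) ler_wpM2l ?mulr_ge0// -(lr_avg_expo genG _ bad T0).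
  rewrite -[leRHS](lr_avg_cst genG _ (binit_sum wpP s0)).
  by apply: (lr_avg_mono genG HD mu0 muD) => y Dy; exact: conc.
apply: (@le_trans _ _ (N%:R * Cg * (b1 * expR (- (c1 * N%:R))))); first by lra.
have := linear_expR_le N%:R c0; rewrite {1}/c (mulrC 2) divfK ?pnatr_eq0// => L.
have -> : N%:R * Cg * (b1 * expR (- (c1 * N%:R))) = Cg * b1 * (N%:R * expR (- (c1 * N%:R))) by ring.
apply: (@le_trans _ _ (Cg * b1 * (c^-1 * expR (- (c * N%:R))))).
  by rewrite ler_wpM2l// mulr_ge0// ltW.
by rewrite mulrA mulrDl lerDl mul1r expR_ge0.
Qed.
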